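(* Let $\{X_t\}_{t\ge1}$ be a stationary Gaussian AR(1) process, $X_{t+1}=aX_t+\varepsilon_{t+1}$ with $\varepsilon_t$ i.i.d. $N(0,\sigma^2)$, where $|a|<1$ and $\sigma>0$ are unknown. Let $W_2,W_4,\dots$ be the pairwise-betting wealth process defined in the context. Then $\frac{\log(W_{2n})}{2n}\to r^*$ almost surely as $n\to\infty$, where $r^*=\frac12\mathbb{E}\left(\log S_4\right)\ge 0$, and $r^*=0$ if and only if $a=0$.
   Context: For parameters $(a,\sigma^2)$ let $f(x,y,z)=\frac{1}{2\pi\sigma^2}\exp\left(-\frac{(y-ax)^2}{2\sigma^2}-\frac{(z-ay)^2}{2\sigma^2}\right)$, and define the oracle score $S_4=\frac{2f(X_2,X_3,X_4)}{f(X_2,X_3,X_4)+f(X_2,X_4,X_3)}$ using the true $a,\sigma^2$. For odd $t\ge3$, let $\hat a_{t-1}=\sum_{i=2}^{t-1}X_iX_{i-1}/\sum_{i=1}^{t-2}X_i^2$, $\hat\sigma^2_{t-1}=\frac{1}{t-2}\sum_{i=2}^{t-1}(X_i-\hat a_{t-1}X_{i-1})^2$, let $\hat f_{t-1}$ be $f$ with $(a,\sigma^2)$ replaced by $(\hat a_{t-1},\hat\sigma^2_{t-1})$, and $$\hat S_{t+1}=\frac{2\hat{f}_{t-1}(X_{t-1},X_t,X_{t+1})}{\hat{f}_{t-1}(X_{t-1},X_t,X_{t+1})+\hat{f}_{t-1}(X_{t-1},X_{t+1},X_t)}$$ (set to $1$ when the estimates are degenerate). The wealth process is $W_2=1$ and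 $W_{t+1}=W_{t-1}\hat S_{t+1}$ for odd $t\ge3$. *)

(* Defs.v *)
From HB Require Import structures.
From mathcomp Require Import all_boot all_order all_algebra.
From mathcomp Require Import all_classical all_reals all_analysis.
Set Implicit Arguments. Unset Strict Implicit. Unset Printing Implicit Defensive.
Import Order.TTheory GRing.Theory Num.Theory.
Local Open Scope classical_set_scope.
Local Open Scope ring_scope.

Section defs.
Context {R : realType}.

Definition ar_density (a s2 x y z : R) : R :=
  (2 * pi * s2)^-1 *
  expR (- ((y - a * x) ^+ 2 / (2 * s2)) - (z - a * y) ^+ 2 / (2 * s2)).

(* 2 f(x,y,z) / (f(x,y,z) + f(x,z,y)) ; the oracle S_4 is
   pair_score a (sigma^2) X_2 X_3 X_4 *)
Definition pair_score (a s2 x y z : R) : R :=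
  2 * ar_density a s2 x y z / (ar_density a s2 x y z + ar_density a s2 x z y).

(* the path x is indexed from 1: x 1, x 2, ... ; m plays the role of t-1 *)
Definition ahat_den (x : nat -> R) (m : nat) : R :=
  \sum_(1 <= i < m) x i ^+ 2.

Definition ahat (x : nat -> R) (m : nat) : R :=
  (\sum_(2 <= i < m.+1) x i * x i.-1) / ahat_den x m.

Definition s2hat (x : nat -> R) (m : nat) : R :=
  (m.-1)%:R^-1 * \sum_(2 <= i < m.+1) (x i - ahat x m * x i.-1) ^+ 2.

(* hat S_{t+1}, set to 1 when the estimates are degenerate *)
Definition Shat (x : nat -> R) (t : nat) : R :=
  let m := t.-1 in
  if (ahat_den x m == 0) || (s2hat x m <= 0) then 1
  else pair_score (ahat x m) (s2hat x m) (x m) (x t) (x t.+1).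

(* wealth x n = W_{2n}:  W_2 = 1, W_{2n} = W_{2n-2} * hat S_{2n} (t = 2n-1) *)
Fixpoint wealth (x : nat -> R) (n : nat) : R :=
  if n is n'.+1 then
    (if n' is 0 then 1 else wealth x n' * Shat x (n.*2).-1)
  else 1.

Definition mutually_independent d (T : measurableType d)
    (P : probability T R) (F : nat -> T -> R) : Prop :=
  forall (J : seq nat) (B : nat -> set R), uniq J ->
    (forall j, measurable (B j)) ->
    fine (P (\big[setI/setT]_(j <- J) (F j @^-1` B j))) =
    \prod_(j <- J) fine (P (F j @^-1` B j)).

End defs.

(* Main.v *)
(* Swapping Y and Z in f(x,y,z) multiplies it by exp U, where
   U = a^2/(2 s2) (y^2 - z^2) - a/s2 x (y - z), so the log-score is
   psi(U) = ln 2 - ln (1 + exp U), a 1-Lipschitz function of U which is linear in the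
   parameters (a^2/(2 s2), a/s2).

   Since E (exp U) = 1 (the swapped density integrates to 1) and psi(u) >= (1 - exp u)/2
   with equality only at u = 0, E psi(U) >= 0, and E psi(U) = 0 forces U = 0 almost surely,
   hence E U = - a^2 (1 - a) s^2 / sigma^2 = 0 and a = 0, where s^2 = E X_t^2.

   Averages over blocks (X_2k, X_2k+1, X_2k+2) of functions of quadratic growth converge
   almost surely: replacing X_t by X_t - a^(t-m) X_m decouples a block from the past up to
   time m at an L^2 cost a^(t-m), so covariances of blocks decay geometrically, and a
   second-moment strong law applies.  This gives the convergence of the average oracle
   log-score, and of the estimators; as psi is Lipschitz and the average of the quadratic
   weights stays bounded, the plug-in error averages out. *)
Require Import Defs.
From HB Require Import structures.
From mathcomp Require Import all_boot all_order all_algebra.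
From mathcomp Require Import zify ring lra.
From mathcomp Require Import all_classical all_reals all_analysis.
From mathcomp Require Import measurable_realfun.
Set Implicit Arguments. Unset Strict Implicit. Unset Printing Implicit Defensive.
Import Order.TTheory GRing.Theory Num.Theory numFieldNormedType.Exports.
Local Open Scope classical_set_scope.
Local Open Scope ring_scope.

(** * Integrals of real functions against a probability *)

Section real_integrals.
Context {R : realType} {d : measure_display} {T : measurableType d} (P : probability T R).
Implicit Types (f g : T -> R) (c : R).

(** As a function of the observations the log-score has quadratic growth, so for [a != 0] it is
    neither bounded nor globally Lipschitz. What survives is a Lipschitz bound whose slope grows
    linearly ([quad_lipschitz]). A coupling error times that slope leaves a quadratic weight, so
    covariances call for fourth moments; these are finite because [exp (h x^2)] is integrable for
    small positive [h]. The hypotheses give only one-variable laws and a product formula for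
    finitely many preimages. Joint laws, and the independence of past and future, are recovered from
    them through the sigma-algebras generated by cylinders. The k-th bet uses estimates that change
    with [k], so the logarithms of the plug-in scores are not values of one fixed function on
    blocks. Linearity of the exponent in the two parameters separates the error into a parameter
    error tending to 0 and a quadratic weight free of parameters, so no uniformity over the
    parameters is involved. This part is deterministic and is carried out on a single path. *)

Definition rint f := P.-integrable setT (EFin \o f).
Definition esp f := Rintegral P setT f.

Lemma rint_measurable f : rint f -> measurable_fun setT f.
Proof. by move=> /integrableP[/measurable_EFinP]. Qed.

Lemma rint_cst c : rint (fun=> c).
Proof. exact: (finite_measure_integrable_cst P c). Qed.

Lemma rintD f g : rint f -> rint g -> rint (fun x => f x + g x).
Proof. exact: integrableD. Qed.

Lemma rintZ c f : rint f -> rint (fun x => c * f x).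
Proof. exact: integrableZl. Qed.

Lemma rintB f g : rint f -> rint g -> rint (fun x => f x - g x).
Proof. exact: integrableB. Qed.

Lemma rint_sum (I : Type) (s : seq I) (F : I -> T -> R) :
  (forall i, rint (F i)) -> rint (fun x => \sum_(i <- s) F i x).
Proof.
move=> iF; elim: s => [|i s ih].
  by rewrite (_ : (fun _ => _) = fun=> 0); [exact: rint_cst|apply/funext => x; rewrite big_nil].
rewrite (_ : (fun _ => _) = fun x => F i x + \sum_(i <- s) F i x); first exact: rintD.
by apply/funext => x; rewrite big_cons.
Qed.

Lemma rint_dom f g : rint g -> measurable_fun setT f -> (forall x, `|f x| <= g x) -> rint f.
Proof.
move=> ig mf fg; apply: le_integrable ig => //; first exact/measurable_EFinP.
by move=> x _ /=; rewrite lee_fin (le_trans (fg x))// ler_norm.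
Qed.

Lemma rint_norm f : rint f -> rint (fun x => `|f x|).
Proof. by move=> fi; exact: integrable_norm. Qed.

Lemma esp_cst c : esp (fun=> c) = c.
Proof. by rewrite /esp (Rintegral_cst P measurableT) [X in fine X]probability_setT mulr1. Qed.

Lemma espD f g : rint f -> rint g -> esp (fun x => f x + g x) = esp f + esp g.
Proof. exact: RintegralD. Qed.

Lemma espB f g : rint f -> rint g -> esp (fun x => f x - g x) = esp f - esp g.
Proof. exact: RintegralB. Qed.

Lemma espZ c f : rint f -> esp (fun x => c * f x) = c * esp f.
Proof. exact: RintegralZl. Qed.

Lemma eq_esp f g : f =1 g -> esp f = esp g.
Proof. by move=> fg; apply: eq_Rintegral => x _. Qed.

Lemma le_esp f g : rint f -> rint g -> (forall x, f x <= g x) -> esp f <= esp g.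
Proof. by move=> fi gi fg; apply: le_Rintegral. Qed.

Lemma esp_ge0 f : (forall x, 0 <= f x) -> 0 <= esp f.
Proof. by move=> f0; apply: Rintegral_ge0. Qed.

Lemma esp_sum (I : Type) (s : seq I) (F : I -> T -> R) :
  (forall i, rint (F i)) -> esp (fun x => \sum_(i <- s) F i x) = \sum_(i <- s) esp (F i).
Proof.
move=> iF; elim: s => [|i s ih].
  by rewrite big_nil -[RHS](esp_cst 0); apply: eq_esp => x; rewrite big_nil.
rewrite big_cons -ih -espD//; last exact: rint_sum.
by apply: eq_esp => x; rewrite big_cons.
Qed.

Lemma le_norm_esp f : rint f -> `|esp f| <= esp (fun x => `|f x|).
Proof. exact: le_normr_Rintegral. Qed.

Lemma EFin_esp f : rint f -> (\int[P]_x (f x)%:E = (esp f)%:E)%E.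
Proof. by move=> fi; rewrite /esp /Rintegral fineK//; exact: integrable_fin_num. Qed.

Lemma ge0_rint f r : measurable_fun setT f -> (forall x, 0 <= f x) ->
  (\int[P]_x (f x)%:E = r%:E)%E -> rint f /\ esp f = r.
Proof.
move=> mf f0 fr; split; last by rewrite /esp /Rintegral fr.
apply/integrableP; split; first exact/measurable_EFinP.
by under eq_integral do rewrite /= ger0_norm//; rewrite fr ltry.
Qed.

End real_integrals.

(** * Gaussian integrals *)

Section gaussian.
Context {R : realType}.
Local Notation mu := (@lebesgue_measure R).

Lemma lebesgue_measure_shift (c : R) (A : set R) : measurable A ->
  mu (shift c @^-1` A) = mu A.
Proof.
move=> mA; apply/esym.
have mc : measurable_fun [set: measurableTypeR R] (shift c : _ -> measurableTypeR R).
  by apply: measurable_funD => //.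
pose m : {measure set (measurableTypeR R) -> \bar R} :=
  measure_function_pushforward__canonical__measure_function_Measure mu mc.
apply: (@lebesgue_measure_unique _ m) => //.
move=> X [[x y] _ <-]; rewrite /m /= /pushforward.
have -> : (shift c : R -> R) @^-1` `]x, y] = `]x - c, y - c]%classic.
  by apply/seteqP; split => z /=; rewrite !in_itv/= ltrBlDr lerBrDr.
rewrite !lebesgue_measure_itv/= !lte_fin ltrD2r; case: ifP => // _.
by rewrite -!EFinB; congr (_%:E); ring.
Qed.

Lemma ge0_integral_shift (c : R) (f : R -> \bar R) : measurable_fun setT f ->
  (forall x, 0 <= f x)%E ->
  (\int[mu]_x f (x + c)%R = \int[mu]_x f x)%E.
Proof.
move=> mf f0.
have mc : measurable_fun [set: measurableTypeR R] (shift c : _ -> measurableTypeR R).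
  by apply: measurable_funD => //.
have := @ge0_integral_pushforward _ _ _ _ R _ mc mu setT f measurableT mf (fun y _ => f0 y).
rewrite preimage_setT => <-.
by apply: eq_measure_integral => A mA _; exact: lebesgue_measure_shift.
Qed.

(** The change of variables is available with the Radon-Nikodym derivative, which agrees almost
    everywhere with [normal_pdf] because both have the same integral over every measurable set. *)
Lemma ge0_integral_normal_prob (m s : R) (f : R -> \bar R) :
  measurable_fun setT f -> (forall x, 0 <= f x)%E ->
  (\int[normal_prob m s]_x f x = \int[mu]_x (f x * (normal_pdf m s x)%:E))%E.
Proof.
move=> mf f0; pose nu := normal_prob m s.
have nm : nu `<< mu by exact: normal_prob_dominates.
rewrite -(Radon_Nikodym_SigmaFinite.change_of_variables nm f0 measurableT mf).
have mg := measurable_int _ (Radon_Nikodym_SigmaFinite.f_integrable nm).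
apply: ae_eq_integral => //.
- exact: emeasurable_funM.
- apply: emeasurable_funM => //; apply/measurable_EFinP; exact: measurable_normal_pdf.
apply: ae_eqe_mul2l.
apply: integral_ae_eq => //.
- exact: Radon_Nikodym_SigmaFinite.f_integrable.
- apply/measurable_EFinP; exact: measurable_normal_pdf.
- by move=> A _ mA; rewrite -Radon_Nikodym_SigmaFinite.f_integral.
Qed.

Lemma normal_pdf_shift (m s c x : R) : s != 0 -> normal_pdf m s (x - c) = normal_pdf (m + c) s x.
Proof.
move=> s0; rewrite !normal_pdfE// /normal_fun.
by rewrite (_ : x - c - m = x - (m + c))//; ring.
Qed.

Lemma ge0_integral_normal_shift (s c : R) (f : R -> \bar R) : s != 0 ->
  measurable_fun setT f -> (forall x, 0 <= f x)%E ->
  (\int[normal_prob 0 s]_x f (c + x)%R = \int[mu]_x (f x * (normal_pdf c s x)%:E))%E.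
Proof.
move=> s0 mf f0; rewrite (@ge0_integral_normal_prob 0 s (fun x => f (c + x))); last 2 first.
- by apply: measurableT_comp => //; exact: measurable_funD.
- by move=> x; exact: f0.
rewrite -(@ge0_integral_shift (- c) (fun x => f (c + x)%R * (normal_pdf 0 s x)%:E)%E); last 2 first.
- apply: emeasurable_funM; last by apply/measurable_EFinP; exact: measurable_normal_pdf.
  by apply: measurableT_comp => //; exact: measurable_funD.
- by move=> x; rewrite mule_ge0// lee_fin normal_pdf_ge0.
by apply: eq_integral => x _; rewrite normal_pdf_shift// add0r addrC subrK.
Qed.

(** Detailed balance: when [t ^+ 2] is the stationary variance, the two exponents add up to
    [- (x^2 + y^2 - 2 a x y) / (2 s^2)], which is symmetric in [x] and [y]. *)
Lemma normal_pdf_reversible (a s t x y : R) : s != 0 -> t != 0 -> s ^+ 2 = (1 - a ^+ 2) * t ^+ 2 ->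
  normal_pdf 0 t x * normal_pdf (a * x) s y = normal_pdf 0 t y * normal_pdf (a * y) s x.
Proof.
move=> s0 t0 st; rewrite !normal_pdfE// /normal_fun.
rewrite mulrACA [RHS]mulrACA -!expRD; congr (_ * expR _).
have a1 : 1 - a ^+ 2 != 0.
  by apply: contra_eq_neq st => ->; rewrite mul0r sqrf_eq0.
have -> : (t ^+ 2 *+ 2)^-1 = (1 - a ^+ 2) * (s ^+ 2 *+ 2)^-1.
  by rewrite st -(mulrnAr (1 - a ^+ 2)) [(_ * (_ *+ _))^-1]invfM mulrA divff// mul1r.
by ring.
Qed.

(** After a Tonelli exchange, detailed balance turns the inner integral over the starting point into
    that of a transition density, which is 1. *)
Lemma normal_stationary (a s t : R) (A : set R) : s != 0 -> t != 0 ->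
    s ^+ 2 = (1 - a ^+ 2) * t ^+ 2 -> measurable A ->
  (\int[normal_prob 0 t]_x \int[normal_prob 0 s]_e (\1_A (a * x + e)%R)%:E = normal_prob 0 t A)%E.
Proof.
move=> s0 t0 st mA.
have mI : measurable_fun setT (fun x : R => (\1_A x : R)%:E) by exact/measurable_EFinP.
have mp : measurable_fun setT (fun xy : R * R => normal_pdf (a * xy.1) s xy.2).
  rewrite (_ : (fun _ => _) = fun xy => normal_peak s * normal_fun (a * xy.1) s xy.2); last first.
    by apply/funext => z; rewrite normal_pdfE.
  apply: measurable_funM => //.
  apply: measurableT_comp => //; apply: measurable_funM => //.
  apply: measurableT_comp => //; apply: measurable_funX.
  apply: measurable_funB => //; exact: measurable_funM.
have mpt : measurable_fun setT (fun x => (normal_pdf 0 t x)%:E).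
  apply/measurable_EFinP; exact: measurable_normal_pdf.
pose g (xy : R * R) := ((\1_A xy.2 : R)%:E * (normal_pdf (a * xy.1) s xy.2)%:E)%E.
have mg : measurable_fun setT g.
  apply: emeasurable_funM; apply/measurable_EFinP => //.
  by apply: (measurableT_comp (_ : measurable_fun setT (\1_A : R -> R))).
have g0 xy : (0 <= g xy)%E by rewrite mule_ge0// lee_fin// normal_pdf_ge0.
transitivity (\int[normal_prob 0 t]_x \int[mu]_y g (x, y))%E.
  apply: eq_integral => x _.
  by apply: (@ge0_integral_normal_shift _ _ (fun y => (\1_A y)%:E)) => // y; rewrite lee_fin.
rewrite ge0_integral_normal_prob//; last 2 first.
- have := @measurable_fun_fubini_tonelli_F _ _ _ _ R mu g mg g0.
  by rewrite /fubini_F.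
- by move=> x; exact: integral_ge0.
transitivity (\int[mu]_x \int[mu]_y (g (x, y) * (normal_pdf 0 t x)%:E))%E.
  apply: eq_integral => x _; rewrite -ge0_integralZr//; last by rewrite lee_fin normal_pdf_ge0.
  by apply: measurableT_comp => //; exact: (measurableT_comp mg).
rewrite (@fubini_tonelli _ _ _ _ _ mu mu (fun xy => g xy * (normal_pdf 0 t xy.1)%:E)%E)/=; last 2
  first.
- by apply: emeasurable_funM => //; exact: (measurableT_comp mpt measurable_fst).
- by move=> x; rewrite mule_ge0// lee_fin normal_pdf_ge0.
rewrite /normal_prob [RHS]integral_mkcond.
apply: eq_integral => y _; rewrite /g/=.
transitivity (\int[mu]_x (((\1_A y : R) * normal_pdf 0 t y)%:E * (normal_pdf (a * y) s x)%:E))%E.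
  apply: eq_integral => x _; rewrite -!EFinM; congr (_%:E).
  by rewrite -mulrA [normal_pdf (a * x) s y * _]mulrC (@normal_pdf_reversible a s t)// mulrA.
rewrite integralZl//; last exact: integrable_normal_pdf.
rewrite integral_normal_pdf mule1 patchE indicE; case: ifPn => _; by rewrite ?mul1r ?mul0r.
Qed.

(** Completing the square: the exponential factor moves the centre of the density from [0] to
    [t * s ^+ 2]. *)
Lemma integral_normal_tilt (t s : R) : s != 0 ->
  (\int[normal_prob 0 s]_x (expR (t * x - t ^+ 2 * s ^+ 2 / 2))%:E = 1)%E.
Proof.
move=> s0; rewrite ge0_integral_normal_prob; last 2 first.
- apply/measurable_EFinP; apply: measurableT_comp => //.
  by apply: measurable_funB => //; exact: measurable_funM.
- by move=> x; rewrite lee_fin expR_ge0.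
have key (x : R) : expR (t * x - t ^+ 2 * s ^+ 2 / 2) * normal_pdf 0 s x = normal_pdf (t * s ^+
  2) s x.
  rewrite !normal_pdfE// /normal_fun mulrCA -expRD; congr (_ * expR _).
  by field.
rewrite -(integral_normal_pdf (t * s ^+ 2) s).
by apply: eq_integral => x _; rewrite -EFinM key.
Qed.

(** The parameter [r] is a dilation: the exponential turns the density of standard deviation [s]
    into [r] times the density of standard deviation [r * s]. *)
Lemma integral_expR_sqr_normal_prob (s r : R) : s != 0 -> 0 < r ->
  (\int[normal_prob 0 s]_x (expR ((1 - r ^- 2) / (s ^+ 2 *+ 2) * x ^+ 2))%:E = r%:E)%E.
Proof.
move=> s0 r0; rewrite ge0_integral_normal_prob; last 2 first.
- apply/measurable_EFinP; apply: measurableT_comp => //.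
  by apply: measurable_funM => //; exact: measurable_funX.
- by move=> x; rewrite lee_fin expR_ge0.
have rn0 : r != 0 by rewrite gt_eqF.
have rs0 : r * s != 0 by rewrite mulf_neq0.
have key (x : R) : expR ((1 - r ^- 2) / (s ^+ 2 *+ 2) * x ^+ 2) * normal_pdf 0 s x
    = r * normal_pdf 0 (r * s) x.
  rewrite !normal_pdfE// /normal_fun /normal_peak mulrCA -expRD [RHS]mulrA; congr (_ * expR _).
    have -> : (r * s) ^+ 2 * pi *+ 2 = r ^+ 2 * (s ^+ 2 * pi *+ 2) by ring.
    by rewrite sqrtrM ?sqr_ge0// sqrtr_sqr gtr0_norm// invfM mulrA divff ?mul1r.
  by field; rewrite s0 rn0.
transitivity (\int[mu]_x (r%:E * (normal_pdf 0 (r * s) x)%:E))%E.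
  by apply: eq_integral => x _; rewrite -!EFinM key.
by rewrite integralZl// ?integral_normal_pdf ?mule1//; exact: integrable_normal_pdf.
Qed.

(* Both sides vanish at [r = 1], so their derivatives there agree. *)
Lemma half_of_tangent (k : R) : (forall r, 0 < r -> (1 - r ^- 2) * k <= r - 1) -> k = 2^-1.
Proof.
move=> H.
have tangent (r : R) : 0 < r -> (r ^+ 2 - 1) * k <= (r - 1) * r ^+ 2.
  move=> r0; have := H r r0; rewrite -(@ler_pM2r _ (r ^+ 2)) ?exprn_gt0//.
  suff -> : (1 - r ^- 2) * k * r ^+ 2 = (r ^+ 2 - 1) * k by [].
  by field; rewrite gt_eqF.
apply/eqP; rewrite eq_le; apply/andP; split; rewrite leNgt; apply/negP => kh.
- pose e := k - 2^-1; have e0 : 0 < e by rewrite subr_gt0.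
  (* After division by [d], the inequality at [r = 1 + d] reads [2 e <= 3 d / 2 - d e + d^2], which
     fails because [d] is below both [e / 2] and [1 / 2]. The same step size, taken to the left of
     1, serves in the second case. *)
  pose d := e / (2 * (1 + e)).
  have d0 : 0 < d by rewrite divr_gt0// mulr_gt0// addr_gt0.
  have dE : d * (2 * (1 + e)) = e by rewrite /d mulfVK// mulf_neq0// gt_eqF// addr_gt0.
  have kE : k = 2^-1 + e by rewrite /e; ring.
  have := tangent (1 + d); rewrite kE => /(_ ltac:(lra)).
  have -> : ((1 + d) ^+ 2 - 1) * (2^-1 + e) = d * ((2 + d) * (2^-1 + e)) by ring.
  have -> : 1 + d - 1 = d by ring.
  rewrite ler_pM2l//.
  nra.
- pose e := 2^-1 - k; have e0 : 0 < e by rewrite subr_gt0.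
  pose d := e / (2 * (1 + e)).
  have d0 : 0 < d by rewrite divr_gt0// mulr_gt0// addr_gt0.
  have dE : d * (2 * (1 + e)) = e by rewrite /d mulfVK// mulf_neq0// gt_eqF// addr_gt0.
  have d2 : d < 2^-1 by nra.
  have kE : k = 2^-1 - e by rewrite /e; ring.
  have := tangent (1 - d); rewrite kE => /(_ ltac:(lra)).
  have -> : ((1 - d) ^+ 2 - 1) * (2^-1 - e) = - d * ((2 - d) * (2^-1 - e)) by ring.
  have -> : (1 - d - 1) = - d by ring.
  rewrite !mulNr lerN2 ler_pM2l//.
  nra.
Qed.

(* [normal_prob] lives on [measurableTypeR R]; random variables use the canonical
   measurable structure of [R], which has the same sets but another display. *)
Lemma measurable_fun_idR : measurable_fun (setT : set (measurableTypeR R)) (id : _ -> R).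
Proof. by move=> _ B mB; rewrite setTI. Qed.

Definition idR : {mfun measurableTypeR R >-> R} :=
  HB.pack (id : measurableTypeR R -> R) (isMeasurableFun.Build _ _ _ _ _ measurable_fun_idR).

Definition centered_normal (s : R) : probability R R := distribution (normal_prob 0 s) idR.

Lemma ge0_integral_centered_normal (s : R) (f : R -> \bar R) :
  measurable_fun setT f -> (forall x, 0 <= f x)%E ->
  (\int[centered_normal s]_x f x = \int[normal_prob 0 s]_x f x)%E.
Proof. by move=> mf f0; exact: (ge0_integral_distribution idR mf f0). Qed.

Section moments.
Context (s : R) (s0 : s != 0).
Let N := centered_normal s.

Lemma rint_normal_expR_sqr (r : R) : 0 < r ->
  rint N (fun x : R => expR ((1 - r ^- 2) / (s ^+ 2 *+ 2) * x ^+ 2)) /\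
  esp N (fun x : R => expR ((1 - r ^- 2) / (s ^+ 2 *+ 2) * x ^+ 2)) = r.
Proof.
move=> r0; apply: ge0_rint; last 1 first.
- rewrite ge0_integral_centered_normal; first exact: integral_expR_sqr_normal_prob.
  + apply/measurable_EFinP; apply: measurableT_comp => //.
    by apply: measurable_funM => //; exact: measurable_funX.
  + by move=> x; rewrite lee_fin expR_ge0.
- apply: measurableT_comp => //.
  by apply: measurable_funM => //; exact: measurable_funX.
- by move=> x; exact: expR_ge0.
Qed.

Lemma rint_normal_tilt (t : R) :
  rint N (fun x : R => expR (t * x - t ^+ 2 * s ^+ 2 / 2)) /\
  esp N (fun x : R => expR (t * x - t ^+ 2 * s ^+ 2 / 2)) = 1.
Proof.
apply: ge0_rint; last 1 first.
- rewrite ge0_integral_centered_normal; first exact: integral_normal_tilt.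
  + apply/measurable_EFinP; apply: measurableT_comp => //.
    by apply: measurable_funB => //; exact: measurable_funM.
  + by move=> x; rewrite lee_fin expR_ge0.
- apply: measurableT_comp => //.
  by apply: measurable_funB => //; exact: measurable_funM.
- by move=> x; exact: expR_ge0.
Qed.

Lemma rint_normal_pow4 : rint N (fun x : R => x ^+ 4).
Proof.
(* This is the exponent at [r = 2], a positive one for which [exp (h x^2)] is integrable;
   [u^2 <= 4 exp u] for [u >= 0] then dominates the fourth power. *)
pose h := (1 - 2 ^- 2) / (s ^+ 2 *+ 2) : R.
have h0 : 0 < h.
  by rewrite divr_gt0// ?pmulrn_lgt0 ?exprn_even_gt0//; lra.
have [/(rintZ (4 / h ^+ 2)) ih _] := @rint_normal_expR_sqr 2 (ltr0n _ 2).
apply: (rint_dom ih); first exact: measurable_funX.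
have key : forall x : R, `|x ^+ 4| <= 4 / h ^+ 2 * expR (h * x ^+ 2).
  move=> x; rewrite ger0_norm ?exprn_even_ge0//.
  rewrite mulrAC ler_pdivlMr ?exprn_gt0//.
  have u0 : 0 <= h * x ^+ 2 by rewrite mulr_ge0 ?sqr_ge0 ?ltW.
  have := expR_ge1Dx (h * x ^+ 2 / 2).
  have -> : expR (h * x ^+ 2) = expR (h * x ^+ 2 / 2) ^+ 2.
    by rewrite -expRM_natl; congr expR; field.
  have -> : x ^+ 4 * h ^+ 2 = (h * x ^+ 2) ^+ 2 by ring.
  move: (expR _) => E; nra.
exact: key.
Qed.

Lemma rint_normal_sqr : rint N (fun x : R => x ^+ 2).
Proof.
apply: (rint_dom (rintD (rint_cst N 1) rint_normal_pow4)); first exact: measurable_funX.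
have key (x : R) : `|x ^+ 2| <= 1 + x ^+ 4.
  rewrite ger0_norm ?sqr_ge0//.
  have := sqr_ge0 (x ^+ 2 - 1); nra.
exact: key.
Qed.

Lemma rint_normal_id : rint N (fun x : R => x).
Proof.
apply: (rint_dom (rintD (rint_cst N 1) rint_normal_sqr)) => //.
have key (x : R) : `|x| <= 1 + x ^+ 2.
  by rewrite ler_norml; apply/andP; split; nra.
exact: key.
Qed.

(* [1 + u <= exp u] with [u = t x - t^2 s^2 / 2] gives [t m <= t^2 s^2 / 2] for the
   mean [m] and every [t]. *)
Lemma esp_normal_id : esp N (fun x : R => x) = 0.
Proof.
have H t : t * esp N (fun x : R => x) <= t ^+ 2 * (s ^+ 2 / 2).
  have [it et] := rint_normal_tilt t.
  have i1 := rintD (rint_cst N (1 - t ^+ 2 * s ^+ 2 / 2)) (rintZ t rint_normal_id).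
  have := le_esp i1 it; rewrite et espD; [|exact: rint_cst|exact/rintZ/rint_normal_id].
  rewrite espZ; last exact: rint_normal_id.
  rewrite esp_cst => /(_ _)/wrap[]; last by move: (esp _ _) => m; lra.
  by move=> x; rewrite (le_trans _ (expR_ge1Dx _))//; lra.
move: (esp _ _) H => m H.
have s2 : 0 < s ^+ 2 by rewrite exprn_even_gt0.
have sn : s ^+ 2 != 0 by rewrite gt_eqF.
(* This value of [t] minimises the quadratic [t^2 s^2 / 2 - t m]; the inequality becomes
   [m^2 / s^2 <= m^2 / (2 s^2)]. *)
have H1 := H (m / s ^+ 2).
have E1 : m / s ^+ 2 * m = m ^+ 2 / s ^+ 2 by field.
have E2 : (m / s ^+ 2) ^+ 2 * (s ^+ 2 / 2) = m ^+ 2 / s ^+ 2 / 2 by field.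
rewrite E1 E2 in H1.
have h1 : 0 <= m ^+ 2 / s ^+ 2 by rewrite divr_ge0// ?sqr_ge0// ltW.
have : m ^+ 2 / s ^+ 2 = 0 by lra.
by move/eqP; rewrite mulf_eq0 invr_eq0 (negbTE sn) orbF sqrf_eq0 => /eqP.
Qed.

(* [1 + h x^2 <= exp (h x^2)] integrates to [1 + h M <= r] for the second moment [M]
   and [h = (1 - r^-2) / (2 s^2)], an inequality which is tight at [r = 1]. *)
Lemma esp_normal_sqr : esp N (fun x : R => x ^+ 2) = s ^+ 2.
Proof.
have s2 : 0 < s ^+ 2 by rewrite exprn_even_gt0.
suff : esp N (fun x : R => x ^+ 2) / (s ^+ 2 *+ 2) = 2^-1.
  move=> /(congr1 (fun z => z * (s ^+ 2 *+ 2))); rewrite mulfVK ?gt_eqF ?pmulrn_lgt0// => ->.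
  by field.
apply: half_of_tangent => r r0.
have [ir er] := rint_normal_expR_sqr r0.
have i1 := rintD (rint_cst N 1) (rintZ ((1 - r ^- 2) / (s ^+ 2 *+ 2)) rint_normal_sqr).
have := le_esp i1 ir; rewrite er espD; [|exact: rint_cst|exact/rintZ/rint_normal_sqr].
rewrite espZ; last exact: rint_normal_sqr.
rewrite esp_cst => /(_ _)/wrap[]; first by move=> x; exact: expR_ge1Dx.
move: (esp _ _) => m.
by rewrite -mulrA [_^-1 * m]mulrC lerBrDl.
Qed.

End moments.

End gaussian.

(** * The likelihood ratio of the swapped pair *)

Section swap.
Context {R : realType}.
Local Notation mu := (@lebesgue_measure R).

(* The exponent [log (f(x,z,y) / f(x,y,z))], with [s2] the noise variance. *)
Definition swap_exponent (a s2 x y z : R) : R :=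
  a ^+ 2 / (2 * s2) * (y ^+ 2 - z ^+ 2) - a / s2 * (x * (y - z)).

Lemma normal_pdf_swap (a s x y z : R) : s != 0 ->
  expR (swap_exponent a (s ^+ 2) x y z) * (normal_pdf (a * x) s y * normal_pdf (a * y) s z) =
  normal_pdf (a * x) s z * normal_pdf (a * z) s y.
Proof.
move=> s0; rewrite !normal_pdfE// /normal_fun (mulrACA (normal_peak s)) [RHS]mulrACA [LHS]mulrCA
  -!expRD.
by congr (_ * expR _); rewrite /swap_exponent; field.
Qed.

Lemma measurable_fun_expR_swap (a s2 : R) d (T : measurableType d) (f g h : T -> R) :
  measurable_fun setT f -> measurable_fun setT g -> measurable_fun setT h ->
  measurable_fun setT (fun w => expR (swap_exponent a s2 (f w) (g w) (h w))).
Proof.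
move=> mf mg mh; apply: measurableT_comp => //; apply: measurable_funB.
- by apply: measurable_funM => //; apply: measurable_funB; exact: measurable_funX.
- by apply: measurable_funM => //; apply: measurable_funM => //; exact: measurable_funB.
Qed.

Lemma measurable_fun_normal_pdf2 (s : R) d (T : measurableType d) (f g : T -> R) : s != 0 ->
  measurable_fun setT f -> measurable_fun setT g ->
  measurable_fun setT (fun w => normal_pdf (f w) s (g w)).
Proof.
move=> s0 mf mg.
rewrite (_ : (fun _ => _) = fun w => normal_peak s * normal_fun (f w) s (g w)); last first.
  by apply/funext => w; rewrite normal_pdfE.
apply: measurable_funM => //; apply: measurableT_comp => //; apply: measurable_funM => //.
by apply: measurableT_comp => //; apply: measurable_funX; exact: measurable_funB.
Qed.

(* The exponential turns [f(x,y,z)] into [f(x,z,y)], which Tonelli integrates to [1]. *)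
Lemma integral_expR_swap (a s x : R) : s != 0 ->
  (\int[centered_normal s]_e \int[centered_normal s]_e'
     (expR (swap_exponent a (s ^+ 2) x (a * x + e) (a * (a * x + e) + e')))%:E = 1)%E.
Proof.
move=> s0.
pose U y z := (expR (swap_exponent a (s ^+ 2) x y z))%:E : \bar R.
have U0 y z : (0 <= U y z)%E by rewrite lee_fin expR_ge0.
have mU y : measurable_fun setT (U y).
  by apply/measurable_EFinP; exact: measurable_fun_expR_swap.
pose g (yz : R * R) := (U yz.1 yz.2 * (normal_pdf (a * yz.1) s yz.2)%:E)%E.
have g0 yz : (0 <= g yz)%E by rewrite mule_ge0// lee_fin normal_pdf_ge0.
have mg : measurable_fun setT g.
  apply: emeasurable_funM; apply/measurable_EFinP; first exact: measurable_fun_expR_swap.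
  by apply: measurable_fun_normal_pdf2 => //; exact: measurable_funM.
have mG := @measurable_fun_fubini_tonelli_F _ _ _ _ R mu g mg g0.
have G0 y : (0 <= \int[mu]_z g (y, z))%E by exact: integral_ge0.
transitivity (\int[centered_normal s]_e \int[mu]_z g ((a * x + e)%R, z))%E.
  apply: eq_integral => e _.
  rewrite (@ge0_integral_centered_normal _ s (fun e' => U (a * x + e) (a * (a * x + e) + e')))//;
    last first.
    by apply: measurableT_comp => //; exact: measurable_funD.
  by rewrite ge0_integral_normal_shift.
rewrite (@ge0_integral_centered_normal _ s (fun e => \int[mu]_z g ((a * x + e)%R, z))%E); last 2
  first.
- by apply: (measurableT_comp mG); exact: measurable_funD.
- by move=> e; exact: G0.
rewrite (@ge0_integral_normal_shift _ s (a * x) (fun y => \int[mu]_z g (y, z))%E s0 mG G0).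
pose k (yz : R * R) := ((normal_pdf (a * x) s yz.2)%:E * (normal_pdf (a * yz.2) s yz.1)%:E)%E.
have k0 yz : (0 <= k yz)%E by rewrite mule_ge0// lee_fin normal_pdf_ge0.
have mk : measurable_fun setT k.
  apply: emeasurable_funM; apply/measurable_EFinP.
    by apply: measurable_fun_normal_pdf2.
  by apply: measurable_fun_normal_pdf2 => //; exact: measurable_funM.
transitivity (\int[mu]_y \int[mu]_z k (y, z))%E.
  apply: eq_integral => y _; rewrite -ge0_integralZr; last 4 first.
  - exact: measurableT.
  - exact: (measurableT_comp mg (measurable_pair1 y)).
  - by move=> z _; exact: g0.
  - by rewrite lee_fin normal_pdf_ge0.
  apply: eq_integral => z _; rewrite /g /k /U -!EFinM -normal_pdf_swap//.
  by congr EFin; rewrite -mulrA [normal_pdf (a * y) s z * _]mulrC.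
rewrite (@fubini_tonelli _ _ _ _ R mu mu k mk k0).
transitivity (\int[mu]_z (normal_pdf (a * x) s z)%:E)%E; last exact: integral_normal_pdf.
apply: eq_integral => z _; rewrite /k/= integralZl//; last exact: integrable_normal_pdf.
by rewrite integral_normal_pdf mule1.
Qed.

End swap.

(** A local Lipschitz condition whose slope grows linearly. It holds for quadratic forms and is
    preserved by composition with 1-Lipschitz functions, hence covers both the sums in the
    estimators and the log-score. *)
Definition quad_lipschitz (R : realType) (C : R) (h : R * R * R -> R) :=
  forall x y z x' y' z', `|h (x, y, z) - h (x', y', z')| <=
    C * ((`|x - x'| + `|y - y'| + `|z - z'|) * (`|x| + `|y| + `|z| + (`|x'| + `|y'| + `|z'|))).

(** * Independence *)

Section independence.
Context {R : realType} {d : measure_display} {T : measurableType d} (P : probability T R).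

Definition indep_fun d1 d2 (S1 : measurableType d1) (S2 : measurableType d2)
    (U : T -> S1) (V : T -> S2) :=
  forall A B, measurable A -> measurable B ->
    P (U @^-1` A `&` V @^-1` B) = (P (U @^-1` A) * P (V @^-1` B))%E.

(** For fixed [B], the restriction of [P] to [B] and [P] scaled by [P B] are finite measures that
    agree on a pi-system containing the whole space. *)
Lemma indep_sigmal (G : set (set T)) (B : set T) : setI_closed G -> G setT ->
    G `<=` measurable -> measurable B ->
    (forall A, G A -> P (A `&` B) = (P A * P B)%E) ->
  forall A, <<s G >> A -> P (A `&` B) = (P A * P B)%E.
Proof.
move=> GI GT Gm mB H A sA.
have fB : P B \is a fin_num by exact: fin_num_measure.
pose k : {nonneg R} := NngNum (fine_ge0 (measure_ge0 P B)).
have kE C : mscale k P C = (P C * P B)%E by rewrite /mscale/= fineK// muleC.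
rewrite -kE -[LHS]/(mrestr P mB A).
apply: (@g_sigma_algebra_measure_unique _ R T G Gm (fun=> setT) (fun=> GT) _
  (mrestr P mB) (mscale k P) GI) => //.
- by rewrite -subTset => x _; exists 0%N.
- by move=> C GC; transitivity (P C * P B)%E; [exact: H|exact/esym/kE].
- by move=> _; rewrite -[X in (X < _)%E]/(P (setT `&` B)) setTI ltey_eq fB.
Qed.

Lemma indep_sigma (G H : set (set T)) : setI_closed G -> setI_closed H ->
    G setT -> H setT -> G `<=` measurable -> H `<=` measurable ->
    (forall A B, G A -> H B -> P (A `&` B) = (P A * P B)%E) ->
  forall A B, <<s G >> A -> <<s H >> B -> P (A `&` B) = (P A * P B)%E.
Proof.
move=> GI HI GT HT Gm Hm GH A B sA sB.
have sm (K : set (set T)) : K `<=` measurable -> <<s K >> `<=` measurable.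
  move=> Km; apply: smallest_sub => //; exact: sigma_algebra_measurable.
apply: (@indep_sigmal G) => //; first exact: (sm H).
move=> C GC; rewrite setIC muleC; apply: (@indep_sigmal H) => //; first exact: Gm.
by move=> D HD; rewrite setIC muleC; exact: GH.
Qed.

Section joint.
Context d1 d2 (S1 : measurableType d1) (S2 : measurableType d2).
Context (U : {mfun T >-> S1}) (V : {mfun T >-> S2}) (UV : indep_fun U V).

Let mUV : measurable_fun setT (fun w => (U w, V w)).
Proof. exact: measurable_fun_pair. Qed.

Let W : {mfun T >-> (S1 * S2)%type} := HB.pack (fun w => (U w, V w)) (isMeasurableFun.Build _ _ _
  _ _ mUV).

Lemma distribution_indep A : measurable A ->
  (distribution P U \x distribution P V)%E A = P ((fun w => (U w, V w)) @^-1` A).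
Proof.
move=> mA; rewrite -[RHS]/(distribution P W A).
apply: product_measure_unique => [B C mB mC|//].
exact: UV.
Qed.

Lemma ge0_integral_indep (f : S1 * S2 -> \bar R) : measurable_fun setT f -> (forall z, 0 <= f
  z)%E ->
  (\int[P]_w f (U w, V w) = \int[distribution P U]_x \int[distribution P V]_y f (x, y))%E.
Proof.
move=> mf f0; rewrite -fubini_tonelli1//.
have := ge0_integral_distribution (P := P) W mf f0 => /= <-.
by apply: eq_measure_integral => A mA _; exact/esym/distribution_indep.
Qed.
End joint.

Lemma indep_espM (U V : {mfun T >-> R}) : indep_fun U V -> rint P U -> rint P V ->
  rint P (fun w => U w * V w) -> esp P (fun w => U w * V w) = esp P U * esp P V.
Proof.
move=> UV iU iV iUV.
have mUV : measurable_fun setT (fun w => (U w, V w)) by exact: measurable_fun_pair.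
pose W : {mfun T >-> (R * R)%type} := HB.pack (fun w => (U w, V w)) (isMeasurableFun.Build _ _ _
  _ _ mUV).
have mM : measurable_fun setT (fun z : R * R => (z.1 * z.2)%:E).
  by apply/measurable_EFinP; exact: measurable_funM.
have EW : forall A, measurable A -> A `<=` setT ->
    distribution P W A = (distribution P U \x distribution P V)%E A.
  by move=> A mA _; rewrite distribution_indep.
have iW : (distribution P W).-integrable setT (fun z : R * R => (z.1 * z.2)%:E).
  exact: (@integrable_pushforward _ _ _ _ R _ mUV).
have iWW : (distribution P U \x distribution P V)%E.-integrable setT (fun z : R * R => (z.1 *
  z.2)%:E).
  move/integrableP : iW => [_ iW]; apply/integrableP; split => //.
  by rewrite -(eq_measure_integral _ EW).
have intV : (\int[distribution P V]_y y%:E = (esp P V)%:E)%E.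
  by rewrite integral_distribution ?EFin_esp//; exact/measurable_EFinP.
apply: EFin_inj; rewrite -EFin_esp// EFinM.
have := @integral_distribution _ _ T _ R P W _ mM iUV => /= <-.
rewrite (eq_measure_integral _ EW) -integral12_prod_meas1//=.
rewrite /fubini_F/=.
transitivity (\int[distribution P U]_x (x%:E * (esp P V)%:E))%E.
  apply: eq_integral => x _; rewrite -intV -integralZl//.
  exact: (@integrable_pushforward _ _ _ _ R V).
rewrite integralZr//; last exact: (@integrable_pushforward _ _ _ _ R U).
by rewrite integral_distribution ?EFin_esp//; exact/measurable_EFinP.
Qed.

Definition sigma_measurable (G : set (set T)) d' (S : measurableType d') (U : T -> S) :=
  measurable_fun (setT : set (g_sigma_algebraType G)) U.

Lemma sigma_measurable_indep (G H : set (set T)) d1 d2 (S1 : measurableType d1)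
    (S2 : measurableType d2) (U : T -> S1) (V : T -> S2) :
  (forall A B, <<s G >> A -> <<s H >> B -> P (A `&` B) = (P A * P B)%E) ->
  sigma_measurable G U -> sigma_measurable H V -> indep_fun U V.
Proof.
move=> GH mU mV A B mA mB; apply: GH.
- by have := mU measurableT A mA; rewrite setTI.
- by have := mV measurableT B mB; rewrite setTI.
Qed.

Section cylinders.
Context (F : nat -> T -> R) (mF : forall k, measurable_fun setT (F k))
  (indF : mutually_independent P F).

(** The pi-system generating the events that depend on the coordinates in [I]. Encoding the finitely
    many constraints as a sequence that is eventually [setT] makes the intersection of two cylinders
    pointwise. *)
Definition cylinder (I : pred nat) : set (set T) :=
  [set A | exists (B : nat -> set R) (N : nat), [/\ forall j, measurable (B j),
    forall j, (N <= j)%N -> B j = setT & A = [set w | forall j, I j -> B j (F j w)]]].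

Lemma cylinderI I : setI_closed (cylinder I).
Proof.
move=> _ _ [B [N [mB BN ->]]] [C [M [mC CM ->]]].
exists (fun j => B j `&` C j), (maxn N M); split.
- by move=> j; exact: measurableI.
- by move=> j; rewrite geq_max => /andP[/BN -> /CM ->]; rewrite setIT.
- apply/seteqP; split => w /=.
    by move=> [h1 h2] j Ij; split; [exact: h1|exact: h2].
  by move=> h; split => j Ij; case: (h j Ij).
Qed.

Lemma cylinderT I : cylinder I setT.
Proof. by exists (fun=> setT), 0%N; split => //; apply/seteqP; split. Qed.

Lemma cylinderE (I : pred nat) (B : nat -> set R) (N : nat) : (forall j, (N <= j)%N -> B j =
  setT) ->
  [set w | forall j, I j -> B j (F j w)] =
  \big[setI/setT]_(j <- [seq j <- iota 0 N | I j]) (F j @^-1` B j).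
Proof.
move=> BN; rewrite -bigcap_seq; apply/seteqP; split => w /=.
  by move=> h j /=; rewrite mem_filter => /andP[Ij _]; exact: h.
move=> h j Ij; have [jN|Nj] := ltnP j N; last by rewrite BN.
by apply: h; rewrite /= mem_filter Ij mem_iota.
Qed.

Lemma measurable_cylinder I : cylinder I `<=` measurable.
Proof.
move=> _ [B [N [mB BN ->]]]; rewrite (cylinderE I BN).
apply: bigsetI_measurable => j _; rewrite -[X in measurable X]setTI; exact: mF.
Qed.

Lemma prob_cylinder (I : pred nat) (B : nat -> set R) (N : nat) : (forall j, measurable (B j)) ->
  (forall j, (N <= j)%N -> B j = setT) ->
  fine (P [set w | forall j, I j -> B j (F j w)]) =
  \prod_(j <- iota 0 N | I j) fine (P (F j @^-1` B j)).
Proof.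
move=> mB BN; rewrite (cylinderE I BN) indF ?big_filter//.
by rewrite filter_uniq// iota_uniq.
Qed.

(** As [I] and [J] are disjoint, the two families of constraints merge into one family [E]; the
    intersection is then a single cylinder whose product splits over [I] and [J]. *)
Lemma indep_cylinder (I J : pred nat) A B : (forall j, I j -> ~~ J j) ->
  cylinder I A -> cylinder J B -> P (A `&` B) = (P A * P B)%E.
Proof.
move=> IJ cA cB.
have mA := measurable_cylinder cA; have mB := measurable_cylinder cB.
have mAB : measurable (A `&` B) by exact: measurableI.
rewrite -[LHS]fineK ?fin_num_measure// -[P A]fineK ?fin_num_measure//.
rewrite -[P B]fineK ?fin_num_measure// -EFinM; congr EFin.
move: cA cB => [C [N [mC CN ->]]] [D [M [mD DM ->]]].
pose K := maxn N M.
have CK j : (K <= j)%N -> C j = setT by rewrite geq_max => /andP[/CN].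
have DK j : (K <= j)%N -> D j = setT by rewrite geq_max => /andP[_ /DM].
pose E j := if I j then C j else D j.
have EK j : (K <= j)%N -> E j = setT by rewrite /E; case: ifP => _; [exact: CK|exact: DK].
have mE j : measurable (E j) by rewrite /E; case: ifP.
have -> : [set w | forall j, I j -> C j (F j w)] `&` [set w | forall j, J j -> D j (F j w)] =
    [set w | forall j, I j || J j -> E j (F j w)].
  apply/seteqP; split => w /=.
    move=> [h1 h2] j /orP[] Ij; rewrite /E; first by rewrite [I j]Ij; exact: h1.
    by case: ifP => Ij'; [exact: h1|exact: h2].
  move=> h; split => j Ij; have := h j; rewrite /E Ij ?orbT; first exact.
  case: ifP => Ij' => [_|]; last exact.
  by have := IJ _ Ij'; rewrite Ij.
rewrite (@prob_cylinder (fun j => I j || J j) E K)// (prob_cylinder I mC CK) (prob_cylinder J mD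
  DK).
rewrite (bigID I)/=; congr (_ * _).
  apply: eq_big => j; first by case: (I j); rewrite ?andbT ?andbF.
  by move=> /andP[_ Ij]; rewrite /E Ij.
apply: eq_big => j; last by move=> /andP[_ Ij]; rewrite /E (negbTE Ij).
case: (boolP (I j)) => Ij; rewrite ?andbT ?andbF//.
exact/esym/negbTE/IJ.
Qed.

Lemma sigma_measurable_coord (I : pred nat) k : I k -> sigma_measurable (cylinder I) (F k).
Proof.
move=> Ik _ B mB; rewrite setTI; apply: sub_sigma_algebra.
exists (fun j => if j == k then B else setT), k.+1; split.
- by move=> j; case: ifP.
- by move=> j; case: eqP => // ->; rewrite ltnn.
- apply/seteqP; split => w /=.
    by move=> Bw j Ij; case: eqP => // ->.
  by move=> /(_ k Ik); rewrite eqxx.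
Qed.

Lemma indep_cylinder_fun (I J : pred nat) d1 d2 (S1 : measurableType d1)
    (S2 : measurableType d2) (U : T -> S1) (V : T -> S2) : (forall j, I j -> ~~ J j) ->
  sigma_measurable (cylinder I) U -> sigma_measurable (cylinder J) V -> indep_fun U V.
Proof.
move=> IJ; apply: sigma_measurable_indep; apply: indep_sigma;
  try exact: cylinderI; try exact: cylinderT; try exact: measurable_cylinder.
by move=> A B; exact: indep_cylinder.
Qed.

End cylinders.

End independence.

(** * A second-moment strong law *)

Section strong_law.
Context {R : realType} {d : measure_display} {T : measurableType d} (P : probability T R).

(** The series of the [V n] has a finite integral, so it converges almost everywhere, and the terms
    of a convergent series tend to 0. *)
Lemma ae_cvg0_of_summable (V : nat -> T -> R) (K : R) :
  (forall n, rint P (V n)) -> (forall n w, 0 <= V n w) ->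
  (forall n, \sum_(0 <= i < n) esp P (V i) <= K) ->
  {ae P, forall w, V n w @[n --> \oo] --> 0}.
Proof.
move=> iV V0 VK.
have mV n : measurable_fun setT (fun w => (V n w)%:E) by have /integrableP[] := iV n.
pose g w := (\sum_(0 <= n <oo) (V n w)%:E)%E.
have g0 w : (0 <= g w)%E by apply: nneseries_ge0 => n _ _; rewrite lee_fin.
have ig : P.-integrable setT g.
  apply/integrableP; split.
    by apply: ge0_emeasurable_sum => // n w _ _; rewrite lee_fin.
  under eq_integral do rewrite gee0_abs//.
  rewrite /g integral_nneseries//; last by move=> n w _; rewrite lee_fin.
  under eq_eseriesr do rewrite EFin_esp//.
  apply: (@le_lt_trans _ _ K%:E); last by rewrite ltry.
  apply: lime_le; first by apply: is_cvg_nneseries => n _ _; rewrite lee_fin esp_ge0.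
  by apply: nearW => n; rewrite sumEFin lee_fin.
have := integrable_ae measurableT ig; apply: filterS => w /(_ I) gw.
apply: cvg_series_cvg_0; apply: nondecreasing_is_cvgn.
  by apply/nondecreasing_seqP => n; rewrite /series/= big_nat_recr//= lerDl.
exists (fine (g w)) => _ [n _ <-].
rewrite -lee_fin fineK// /series/= -sumEFin.
by apply: nneseries_lim_ge => k _; rewrite lee_fin.
Qed.

(** Cauchy-Schwarz against the constant sequence 1. *)
Lemma sqr_sum_le (y : nat -> R) m n :
  (\sum_(m <= i < n) y i) ^+ 2 <= (n - m)%:R * \sum_(m <= i < n) y i ^+ 2.
Proof.
have [nm|/ltnW mn] := leqP n m; first by rewrite !big_geq// expr0n/= mulr0.
rewrite -(subnKC mn); move: (n - m)%N => k; rewrite addKn.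
elim: k => [|k ih]; first by rewrite addn0 !big_geq// expr0n/= mulr0.
rewrite addnS !big_nat_recr ?leq_addr//=.
case: k ih => [_|k ih]; first by rewrite addn0 !big_geq// !add0r mul1r.
move: (\sum_(m <= i < m + k.+1) y i) (\sum_(m <= i < m + k.+1) y i ^+ 2) (y (m + k.+1)%N) ih => S
  Q z.
have kp : 0 < (k.+1%:R : R) by [].
rewrite -[k.+2%:R]natr1; move: (k.+1%:R) kp => K kp ih.
have : 2 * S * z <= Q + K * z ^+ 2.
  rewrite -(ler_pM2l kp).
  have := sqr_ge0 (S - K * z); nra.
nra.
Qed.

Lemma sum_inv_sqr_le n : \sum_(0 <= i < n) (i.+1%:R ^- 2 : R) <= 2.
Proof.
case: n => [|n]; first by rewrite big_geq.
suff : \sum_(0 <= i < n.+1) (i.+1%:R ^- 2 : R) <= 2 - n.+1%:R^-1.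
  by move=> /le_trans; apply; rewrite lerBlDr lerDl.
elim: n => [|n ih]; first by rewrite big_nat1 expr1n invr1; lra.
rewrite big_nat_recr//=; apply: le_trans (lerD ih (lexx _)) _.
have kp : 0 < (n.+1%:R : R) by [].
rewrite -[n.+2%:R]natr1; move: (n.+1%:R) kp => K kp.
rewrite -subr_ge0 (_ : _ - _ = (K * (K + 1) ^+ 2)^-1); last first.
  by field; rewrite !gt_eqF// ltr_wpDl// ltW.
by rewrite invr_ge0 mulr_ge0 ?sqr_ge0// ltW.
Qed.

Lemma nat_between_squares M n : (M.+1 ^ 2 <= n)%N ->
  exists m, [/\ (M <= m)%N, (m.+1 ^ 2 <= n)%N & (n < m.+2 ^ 2)%N].
Proof.
move=> Mn.
have ex : exists m, (m.+1 ^ 2 <= n)%N by exists M.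
have ub m : (m.+1 ^ 2 <= n)%N -> (m <= n)%N.
  by move=> h; apply: leq_trans (leqnSn m) (leq_trans _ h); rewrite -mulnn leq_pmulr.
have [m mn mmax] := ex_maxnP ex ub.
exists m; split => //; first exact: mmax.
by rewrite ltnNge; apply/negP => /mmax; rewrite ltnn.
Qed.

(** Between two consecutive squares, the partial sum differs from the one at the lower square by at
    most the sum of absolute values over the whole gap. The hypotheses are squared because second
    moments control them in that form. *)
Lemma cvg_mean_of_squares (y : nat -> R) :
  ((\sum_(0 <= i < m.+1 ^ 2) y i) / m.+1%:R ^+ 2) ^+ 2 @[m --> \oo] --> (0 : R) ->
  ((\sum_(m.+1 ^ 2 <= i < m.+2 ^ 2) `|y i|) / m.+1%:R ^+ 2) ^+ 2 @[m --> \oo] --> (0 : R) ->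
  (\sum_(0 <= i < n) y i) / n%:R @[n --> \oo] --> (0 : R).
Proof.
move=> /cvgrPdist_le h1 /cvgrPdist_le h2; apply/cvgrPdist_le => e e0.
have e2 : 0 < (e / 2) ^+ 2 by rewrite exprn_gt0// divr_gt0.
have [M1 _ H1] := h1 _ e2; have [M2 _ H2] := h2 _ e2.
exists ((maxn M1 M2).+1 ^ 2)%N => // n /= /nat_between_squares[m [Mm mn nm]].
have {}H1 := H1 m (leq_trans (leq_maxl _ _) Mm).
have {}H2 := H2 m (leq_trans (leq_maxr _ _) Mm).
have K0 : 0 < (m.+1%:R : R) ^+ 2 by rewrite exprn_gt0.
have aux (u : R) : `|0 - (u / m.+1%:R ^+ 2) ^+ 2| <= (e / 2) ^+ 2 -> `|u| <= e / 2 * m.+1%:R ^+ 2.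
  rewrite sub0r normrN normrX ler_pXn2r ?nnegrE//; last by rewrite divr_ge0// ltW.
  by rewrite normrM normfV (gtr0_norm K0) ler_pdivrMr.
have {H1}H1 := aux _ H1; have {H2}H2 := aux _ H2.
have n0 : 0 < (n%:R : R) by rewrite ltr0n (leq_trans _ mn)// expn_gt0.
rewrite sub0r normrN normrM normfV (gtr0_norm n0) ler_pdivrMr//.
have Kn : (m.+1%:R : R) ^+ 2 <= n%:R by rewrite -natrX ler_nat.
apply: (@le_trans _ _ (e * m.+1%:R ^+ 2)); last by rewrite ler_pM2l.
rewrite (@big_cat_nat _ _ _ (m.+1 ^ 2))//=.
apply: le_trans (ler_normD _ _) _.
rewrite [e in leRHS](splitr e) mulrDl lerD//.
apply: le_trans (ler_norm_sum _ _ _) (le_trans _ (le_trans (ler_norm _) H2)).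
rewrite [leRHS](@big_cat_nat _ _ _ n)//= ?lerDl ?sumr_ge0//; exact: ltnW.
Qed.

(* Along squares [E (S_(m^2) / m^2)^2] is summable, and so are the second moments of
   the normalised sums of [|Y i|] between consecutive squares. *)
Lemma strong_law_L2 (Y : nat -> T -> R) (C : R) : (forall n, measurable_fun setT (Y n)) ->
  (forall n, rint P (fun w => Y n w ^+ 2)) -> (forall n, esp P (fun w => Y n w ^+ 2) <= C) ->
  (forall n, esp P (fun w => (\sum_(0 <= i < n) Y i w) ^+ 2) <= C * n%:R) ->
  {ae P, forall w, (\sum_(0 <= i < n) Y i w) / n%:R @[n --> \oo] --> (0 : R)}.
Proof.
move=> mY iY YC SC.
have C0 : 0 <= C by apply: le_trans (YC 0%N); apply: esp_ge0 => w; exact: sqr_ge0.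
have isum (Z : nat -> T -> R) m n : (forall n, measurable_fun setT (Z n)) ->
    (forall n w, Z n w ^+ 2 = Y n w ^+ 2) -> rint P (fun w => (\sum_(m <= i < n) Z i w) ^+ 2) /\
    esp P (fun w => (\sum_(m <= i < n) Z i w) ^+ 2) <= (n - m)%:R ^+ 2 * C.
  move=> mZ ZY.
  have iZ : rint P (fun w => (n - m)%:R * \sum_(m <= i < n) Y i w ^+ 2).
    exact/rintZ/rint_sum.
  have le w : (\sum_(m <= i < n) Z i w) ^+ 2 <= (n - m)%:R * \sum_(m <= i < n) Y i w ^+ 2.
    by under [X in _ <= _ * X]eq_bigr do rewrite -ZY; exact: sqr_sum_le.
  have iS : rint P (fun w => (\sum_(m <= i < n) Z i w) ^+ 2).
    apply: (rint_dom iZ); last by move=> w; rewrite ger0_norm ?sqr_ge0.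
    by apply: measurable_funX; exact: measurable_sum.
  split => //; apply: le_trans (le_esp iS iZ le) _.
  rewrite espZ; last exact: rint_sum.
  rewrite esp_sum// expr2 -mulrA ler_wpM2l//.
  by apply: le_trans (ler_sum _ (fun i _ => YC i)) _; rewrite sumr_const_nat mulr_natl.
have V1 : {ae P, forall w, ((\sum_(0 <= i < m.+1 ^ 2) Y i w) / m.+1%:R ^+ 2) ^+ 2 @[m --> \oo]
  --> (0 : R)}.
  have E m w : ((\sum_(0 <= i < m.+1 ^ 2) Y i w) / m.+1%:R ^+ 2) ^+ 2 =
      m.+1%:R ^- 4 * (\sum_(0 <= i < m.+1 ^ 2) Y i w) ^+ 2.
    by rewrite exprMn exprVn -exprM mulrC.
  have i1 m := (isum Y 0%N (m.+1 ^ 2)%N mY (fun _ _ => erefl)).1.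
  apply: (@ae_cvg0_of_summable _ (C * 2)).
  - by move=> m; under eq_fun do rewrite E; exact/rintZ/i1.
  - by move=> m w; exact: sqr_ge0.
  - move=> n; apply: (@le_trans _ _ (C * \sum_(0 <= i < n) i.+1%:R ^- 2)); last first.
      by rewrite ler_wpM2l// sum_inv_sqr_le.
    rewrite mulr_sumr; apply: ler_sum => m _.
    rewrite (eq_esp _ (E m)) espZ; last exact: i1.
    rewrite mulrC ler_pdivrMr ?exprn_gt0//; apply: le_trans (SC _) _.
    rewrite natrX (_ : C / m.+1%:R ^+ 2 * m.+1%:R ^+ 4 = C * m.+1%:R ^+ 2)//.
    by field; rewrite addrC natr1 pnatr_eq0.
have V2 : {ae P, forall w, ((\sum_(m.+1 ^ 2 <= i < m.+2 ^ 2) `|Y i w|) / m.+1%:R ^+ 2) ^+ 2 @[m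
  --> \oo] --> (0 : R)}.
  have E m w : ((\sum_(m.+1 ^ 2 <= i < m.+2 ^ 2) `|Y i w|) / m.+1%:R ^+ 2) ^+ 2 =
      m.+1%:R ^- 4 * (\sum_(m.+1 ^ 2 <= i < m.+2 ^ 2) `|Y i w|) ^+ 2.
    by rewrite exprMn exprVn -exprM mulrC.
  have mN n : measurable_fun setT (fun w => `|Y n w|) by exact: measurableT_comp.
  have i1 m := isum (fun i w => `|Y i w|) (m.+1 ^ 2)%N (m.+2 ^ 2)%N mN (fun n w => real_normK
    (num_real _)).
  (* The gap between consecutive squares has [2 (m + 1) + 1 <= 3 (m + 1)] terms; the square of this
     3 is the 9. *)
  apply: (@ae_cvg0_of_summable _ (9 * C * 2)).
  - by move=> m; under eq_fun do rewrite E; apply/rintZ; have [] := i1 m.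
  - by move=> m w; exact: sqr_ge0.
  - move=> n; apply: (@le_trans _ _ (9 * C * \sum_(0 <= i < n) i.+1%:R ^- 2)); last first.
      by rewrite ler_wpM2l ?sum_inv_sqr_le// mulr_ge0.
    rewrite mulr_sumr; apply: ler_sum => m _.
    have [i1m e1m] := i1 m.
    rewrite (eq_esp _ (E m)) espZ//.
    rewrite mulrC ler_pdivrMr ?exprn_gt0//; apply: le_trans e1m _.
    rewrite (_ : (m.+2 ^ 2 - m.+1 ^ 2)%N = (2 * m.+1 + 1)%N); last first.
      by rewrite -[m.+2]addn1 sqrnD; lia.
    rewrite (_ : 9 * C / m.+1%:R ^+ 2 * m.+1%:R ^+ 4 = 9 * m.+1%:R ^+ 2 * C); last first.
      by field; rewrite addrC natr1 pnatr_eq0.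
    rewrite ler_wpM2r//.
    rewrite natrD natrM.
    have : 1 <= (m.+1%:R : R) by rewrite ler1n.
    move: (m.+1%:R) => K K1; nra.
by move: V1 V2; apply: filterS2 => w; exact: cvg_mean_of_squares.
Qed.

Lemma rint_mul (f g : T -> R) : measurable_fun setT f -> measurable_fun setT g ->
  rint P (fun w => f w ^+ 2) -> rint P (fun w => g w ^+ 2) -> rint P (fun w => f w * g w).
Proof.
move=> mf mg if2 ig2; apply: (rint_dom (rintD if2 ig2)); first exact: measurable_funM.
by move=> w; rewrite ler_norml; apply/andP; split; nra.
Qed.

(** The exponent [j - i.+1], not [j - i], allows for neighbouring blocks that share an observation
    and so show no decay. *)
Lemma strong_law_mixing (Y : nat -> T -> R) (K r : R) : 0 <= r < 1 ->
  (forall n, measurable_fun setT (Y n)) ->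
  (forall n, rint P (fun w => Y n w ^+ 2)) -> (forall n, esp P (fun w => Y n w ^+ 2) <= K) ->
  (forall i j, (i < j)%N -> `|esp P (fun w => Y i w * Y j w)| <= K * r ^+ (j - i.+1)) ->
  {ae P, forall w, (\sum_(0 <= i < n) Y i w) / n%:R @[n --> \oo] --> (0 : R)}.
Proof.
move=> /andP[r0 r1] mY iY YK cov.
have K0 : 0 <= K by apply: le_trans (YK 0%N); apply: esp_ge0 => w; exact: sqr_ge0.
have r1' : 0 < 1 - r by rewrite subr_gt0.
(* Adding one term to the sum raises its second moment by at most [K] for the new square plus twice
   a geometric sum of covariances, itself at most [K / (1 - r)]. *)
pose C := K * (1 + 2 / (1 - r)).
have KC : K <= C by rewrite /C mulrDr mulr1 lerDl mulr_ge0// divr_ge0// ltW.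
have iYY i j := rint_mul (mY i) (mY j) (iY i) (iY j).
have mS n : measurable_fun setT (fun w => \sum_(0 <= i < n) Y i w) by exact: measurable_sum.
apply: (@strong_law_L2 Y C) => // [n|n]; first exact: le_trans KC.
suff [] : rint P (fun w => (\sum_(0 <= i < n) Y i w) ^+ 2) /\
    esp P (fun w => (\sum_(0 <= i < n) Y i w) ^+ 2) <= C * n%:R by [].
elim: n => [|n [iS eS]].
  have E : (fun w => (\sum_(0 <= i < 0) Y i w) ^+ 2) = fun=> 0.
    by apply/funext => w; rewrite big_geq// expr0n.
  by rewrite E esp_cst mulr0; split => //; exact: rint_cst.
have E w : (\sum_(0 <= i < n.+1) Y i w) ^+ 2 =
    (\sum_(0 <= i < n) Y i w) ^+ 2 + (2 * (\sum_(0 <= i < n) Y i w * Y n w) + Y n w ^+ 2).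
  by rewrite big_nat_recr//= -mulr_suml; ring.
have i2 : rint P (fun w => \sum_(0 <= i < n) Y i w * Y n w) by exact: rint_sum.
have i3 := rintD (rintZ 2 i2) (iY n).
split; first by under eq_fun do rewrite E; exact: rintD.
rewrite (eq_esp _ E) espD// espD//; last exact: rintZ.
rewrite espZ// esp_sum// -[n.+1%:R]natr1 (mulrDr C) mulr1 lerD//.
rewrite /C mulrDr mulr1 addrC lerD// mulrCA ler_pM2l//.
apply: (@le_trans _ _ (\sum_(0 <= i < n) K * r ^+ (n - i.+1))).
  rewrite big_nat [leRHS]big_nat; apply: ler_sum => i /andP[_ ni].
  exact: le_trans (ler_norm _) (cov _ _ ni).
rewrite -mulr_sumr ler_wpM2l//.
rewrite big_nat_rev/= add0n (eq_big_nat _ _ (F2 := fun i => r ^+ i)); last first.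
  by move=> i /andP[_ ni]; congr (_ ^+ _); lia.
rewrite -(ler_pM2l r1') divff ?gt_eqF//.
have -> : (1 - r) * \sum_(0 <= i < n) r ^+ i = 1 - r ^+ n.
  by rewrite big_mkord -opprB mulNr -subrX1 opprB.
by rewrite lerBlDr lerDl exprn_ge0.
Qed.

End strong_law.

(** * The autoregressive process *)

Section autoregression.
Context {R : realType} {d : measure_display} {T : measurableType d} (P : probability T R).
Context (a sigma : R) (X eps : nat -> {RV P >-> R}).
Let s := sigma / Num.sqrt (1 - a ^+ 2).
(** The independent driving sequence: [xi 0] is the initial value and [xi k] is [eps k.+1] for
    [k >= 1], so [X t.+1] is a function of [xi 0, ..., xi t]. *)
Let xi k : T -> R := if k is k'.+1 then (eps k'.+2 : T -> R) else (X 1%N : T -> R).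
Context (a1 : `|a| < 1) (sigma0 : 0 < sigma)
  (lawX1 : forall A, measurable A -> distribution P (X 1%N) A = normal_prob 0 s A)
  (lawe : forall t, (2 <= t)%N -> forall A, measurable A -> distribution P (eps t) A =
    normal_prob 0 sigma A)
  (indxi : mutually_independent P xi)
  (XS : forall t w, (1 <= t)%N -> X t.+1 w = a * X t w + eps t.+1 w).

Let N1 := centered_normal s.
Let N2 := centered_normal sigma.

Let a2 : 0 < 1 - a ^+ 2.
Proof. by rewrite subr_gt0 -real_normK ?num_real// expr_lt1. Qed.

Let s0 : s != 0.
Proof. by rewrite gt_eqF// divr_gt0// sqrtr_gt0. Qed.

Let sigman0 : sigma != 0. Proof. by rewrite gt_eqF. Qed.

Lemma stationary_variance : sigma ^+ 2 = (1 - a ^+ 2) * s ^+ 2.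
Proof. by rewrite /s exprMn exprVn sqr_sqrtr ?ltW// mulrCA divff ?mulr1// gt_eqF. Qed.

Let mxi k : measurable_fun setT (xi k).
Proof. by case: k => [|k] /=; exact: measurable_funP. Qed.

Lemma past_measurable m t : (t <= m)%N -> sigma_measurable (cylinder xi (fun j => j <= m)%N) (X
  t.+1).
Proof.
elim: t => [|t ih] tm; first exact: (@sigma_measurable_coord _ _ _ xi _ 0%N).
rewrite /sigma_measurable (_ : (X t.+2 : T -> R) = fun w => a * X t.+1 w + eps t.+2 w); last first.
  by apply/funext => w; rewrite XS.
apply: measurable_funD; first by apply: measurable_funM => //; apply: ih; exact: ltnW.
exact: (@sigma_measurable_coord _ _ _ xi _ t.+1).
Qed.

Lemma past_future_indep m d1 d2 (S1 : measurableType d1) (S2 : measurableType d2)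
    (U : T -> S1) (V : T -> S2) :
  sigma_measurable (cylinder xi (fun j => j <= m)%N) U ->
  sigma_measurable (cylinder xi (fun j => m < j)%N) V -> indep_fun P U V.
Proof. by apply: indep_cylinder_fun => // j; rewrite -leqNgt. Qed.

Lemma innovation_future m : sigma_measurable (cylinder xi (fun j => m < j)%N) (eps m.+2).
Proof. exact: (@sigma_measurable_coord _ _ _ xi _ m.+1). Qed.

Lemma ge0_integral_X_eps (t : nat) (f : R * R -> \bar R) : (1 <= t)%N ->
    measurable_fun setT f -> (forall z, 0 <= f z)%E ->
    (forall A, measurable A -> distribution P (X t) A = N1 A) ->
  (\int[P]_w f (X t w, eps t.+1 w) = \int[N1]_x \int[N2]_e f (x, e))%E.
Proof.
case: t => // t _ mf f0 lawX.
rewrite ge0_integral_indep//; last first.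
  by apply: (@past_future_indep t); [exact: past_measurable|exact: innovation_future].
rewrite (eq_measure_integral N1); last by move=> A mA _; exact: lawX.
by apply: eq_integral => x _; apply: eq_measure_integral => A mA _; exact: lawe.
Qed.

(* [lawX1] propagates by reversibility of the Gaussian transition. *)
Lemma lawX t : (1 <= t)%N -> forall A, measurable A -> distribution P (X t) A = N1 A.
Proof.
case: t => // t _; elim: t => [|t ih] A mA; first exact: lawX1.
have mI : measurable_fun setT (fun z : R * R => \1_A (a * z.1 + z.2) : R).
  apply: (measurableT_comp (_ : measurable_fun setT (\1_A : R -> R))) => //.
  by apply: measurable_funD => //; exact: measurable_funM.
transitivity (\int[N1]_x \int[N2]_e (\1_A (a * x + e)%R)%:E)%E; last first.
  rewrite -[RHS](@normal_stationary _ a sigma s A sigman0 s0 stationary_variance mA).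
  pose g (z : R * R) := (\1_A (a * z.1 + z.2) : R)%:E.
  have mg : measurable_fun setT g by exact/measurable_EFinP.
  have g0 z : (0 <= g z)%E by rewrite lee_fin.
  have mF := @measurable_fun_fubini_tonelli_F _ _ _ _ R N2 g mg g0.
  rewrite (ge0_integral_centered_normal s mF)//; last by move=> x; exact: integral_ge0.
  apply: eq_integral => x _; apply: (@ge0_integral_centered_normal _ _ (fun e => g (x, e))) => //.
  exact: (measurableT_comp mg (measurable_pair1 x)).
rewrite -(@ge0_integral_X_eps t.+1 (fun z => (\1_A (a * z.1 + z.2))%:E))//; last
  exact/measurable_EFinP.
under eq_integral do rewrite -XS//.
rewrite -[RHS]/(\int[P]_w (\1_(X t.+2 @^-1` A) w)%:E)%E integral_indic ?setIT//.
exact: measurable_funPTI.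
Qed.

(** The innovations are peeled off from the last one: [eps t.+2] is independent of the pair of [X t]
    and [eps t.+1]. Since the right side does not mention [t], all blocks have the same law. *)
Lemma ge0_integral_triple (t : nat) (f : R * R * R -> \bar R) : (1 <= t)%N ->
    measurable_fun setT f -> (forall z, 0 <= f z)%E ->
  (\int[P]_w f (X t w, X t.+1 w, X t.+2 w) =
   \int[N1]_x \int[N2]_e \int[N2]_e' f (x, (a * x + e)%R, (a * (a * x + e) + e')%R))%E.
Proof.
case: t => // t _ mf f0.
pose g (z : R * R * R) := f (z.1.1, a * z.1.1 + z.1.2, a * (a * z.1.1 + z.1.2) + z.2).
have m1 : measurable_fun setT (fun z : R * R * R => a * z.1.1 + z.1.2).
  apply: measurable_funD; last exact: measurableT_comp.
  by apply: measurable_funM => //; exact: measurableT_comp.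
have mg : measurable_fun setT g.
  apply: (measurableT_comp mf).
  apply: measurable_fun_pair; first by apply: measurable_fun_pair => //; exact: measurableT_comp.
  by apply: measurable_funD => //; exact: measurable_funM.
have mU : measurable_fun setT (fun w => (X t.+1 w, eps t.+2 w)) by exact: measurable_fun_pair.
pose U : {mfun T >-> (R * R)%type} := HB.pack (fun w => (X t.+1 w, eps t.+2 w))
  (isMeasurableFun.Build _ _ _ _ _ mU).
have UV : indep_fun P U (eps t.+3).
  apply: (@past_future_indep t.+1); last exact: innovation_future.
  apply: measurable_fun_pair; first exact: past_measurable.
  exact: (@sigma_measurable_coord _ _ _ xi _ t.+1).
transitivity (\int[P]_w g (U w, eps t.+3 w))%E.
  by apply: eq_integral => w _; rewrite /g/= -!XS.
have g0 z : (0 <= g z)%E by exact: f0.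
rewrite (ge0_integral_indep UV mg g0).
pose h (z : R * R) := (\int[N2]_e' g (z, e'))%E.
have h0 z : (0 <= h z)%E by exact: integral_ge0.
have mh : measurable_fun setT h by exact: (@measurable_fun_fubini_tonelli_F _ _ _ _ R N2 g mg g0).
transitivity (\int[distribution P U]_z h z)%E.
  by apply: eq_integral => z _; apply: eq_measure_integral => A mA _; exact: lawe.
have := ge0_integral_distribution (P := P) U mh h0 => /= ->.
by rewrite -(@ge0_integral_X_eps t.+1 h)//; exact: lawX.
Qed.

Lemma triple_stationary (t : nat) (h : R * R * R -> R) : (1 <= t)%N -> measurable_fun setT h ->
  esp P (fun w => h (X t w, X t.+1 w, X t.+2 w)) = esp P (fun w => h (X 2 w, X 3 w, X 4 w)).
Proof.
move=> t1 mh; rewrite /esp /Rintegral; congr fine.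
have mE : measurable_fun setT (EFin \o h) by exact/measurable_EFinP.
rewrite integralE [RHS]integralE; congr (_ - _)%E.
- transitivity (\int[P]_w (EFin \o h)^\+ (X t w, X t.+1 w, X t.+2 w))%E; first by apply:
  eq_integral => w _; rewrite ?funeposE ?funenegE.
  rewrite (ge0_integral_triple t1 (measurable_funepos mE))// -(@ge0_integral_triple 2)//; last
    exact: measurable_funepos.
  by apply: eq_integral => w _; rewrite ?funeposE ?funenegE.
- transitivity (\int[P]_w (EFin \o h)^\- (X t w, X t.+1 w, X t.+2 w))%E; first by apply:
  eq_integral => w _; rewrite ?funeposE ?funenegE.
  rewrite (ge0_integral_triple t1 (measurable_funeneg mE))// -(@ge0_integral_triple 2)//; last
    exact: measurable_funeneg.
  by apply: eq_integral => w _; rewrite ?funeposE ?funenegE.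
Qed.

Lemma law_transfer (Z : {RV P >-> R}) (Q : probability _ R) (f : R -> R) :
  (forall A, measurable A -> distribution P Z A = Q A) -> measurable_fun setT f ->
  rint Q f -> rint P (fun w => f (Z w)) /\ esp P (fun w => f (Z w)) = esp Q f.
Proof.
move=> law mf fQ.
have iP : rint P (fun w => f (Z w)).
  apply/integrableP; split; first by apply/measurable_EFinP; exact: measurableT_comp.
  have := @ge0_integral_distribution _ _ _ _ _ P Z (fun x => `|f x|%:E) _ _ => /= <-//.
  - rewrite (eq_measure_integral Q); last by move=> A mA _; exact: law.
    by move/integrableP : fQ => [_].
  - by apply/measurable_EFinP; exact: measurableT_comp.
split => //; rewrite /esp /Rintegral; congr fine.
have := @integral_distribution _ _ _ _ _ P Z (EFin \o f) _ iP => /= <-; last exact/measurable_EFinP.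
by apply: eq_measure_integral => A mA _; exact: law.
Qed.

Lemma X_pow4 t : (1 <= t)%N -> rint P (fun w => X t w ^+ 4) /\
  esp P (fun w => X t w ^+ 4) = esp N1 (fun x : R => x ^+ 4).
Proof.
move=> t1; apply: (law_transfer (f := fun x => x ^+ 4) (Q := N1) (lawX t1)); last exact:
  rint_normal_pow4.
exact: measurable_funX.
Qed.

Lemma X_sqr t : (1 <= t)%N -> rint P (fun w => X t w ^+ 2) /\ esp P (fun w => X t w ^+ 2) = s ^+ 2.
Proof.
move=> t1; rewrite -(esp_normal_sqr s0).
apply: (law_transfer (f := fun x => x ^+ 2) (Q := N1) (lawX t1)); last exact: rint_normal_sqr.
exact: measurable_funX.
Qed.

Lemma X_id t : (1 <= t)%N -> rint P (X t) /\ esp P (X t) = 0.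
Proof.
move=> t1; rewrite -(esp_normal_id s0).
by apply: (law_transfer (f := id) (Q := N1) (lawX t1)) => //; exact: rint_normal_id.
Qed.

Lemma X_mul t u : (1 <= t)%N -> (1 <= u)%N -> rint P (fun w => X t w * X u w).
Proof.
move=> t1 u1; apply: rint_mul; try exact: measurable_funP.
- exact: (X_sqr t1).1.
- exact: (X_sqr u1).1.
Qed.

Lemma X_eps_uncorrelated t u : (1 <= t <= u)%N ->
  rint P (fun w => X t w * eps u.+1 w) /\ esp P (fun w => X t w * eps u.+1 w) = 0.
Proof.
case: t u => [//|t] [//|u] /andP[_ tu].
have le := law_transfer (f := id) (Q := N2) (@lawe u.+2 isT) (@measurable_id _ _ _)
  (rint_normal_id sigman0).
have le2 := law_transfer (f := fun x => x ^+ 2) (Q := N2) (@lawe u.+2 isT) (measurable_funX _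
  (@measurable_id _ _ _)) (rint_normal_sqr sigman0).
have iXe : rint P (fun w => X t.+1 w * eps u.+2 w).
  apply: rint_mul; try exact: measurable_funP; first exact: (X_sqr _).1.
  exact: le2.1.
split=> //; rewrite indep_espM//; first by rewrite (X_id _).2// mul0r.
- by apply: (@past_future_indep u); [exact: past_measurable|exact: innovation_future].
- exact: (X_id _).1.
- exact: le.1.
Qed.

Lemma esp_X_X1 t : (1 <= t)%N -> esp P (fun w => X t w * X t.+1 w) = a * s ^+ 2.
Proof.
move=> t1; have [i1 e1] := X_sqr t1.
have [|i2 e2] := @X_eps_uncorrelated t t; first by rewrite t1 leqnn.
rewrite (@eq_esp _ _ _ _ _ (fun w => a * X t w ^+ 2 + X t w * eps t.+1 w)); last first.
  by move=> w; rewrite XS//; ring.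
by rewrite espD//; [rewrite espZ// e1 e2 addr0|exact: rintZ].
Qed.

Lemma esp_X_X2 t : (1 <= t)%N -> esp P (fun w => X t w * X t.+2 w) = a ^+ 2 * s ^+ 2.
Proof.
move=> t1; have i1 : rint P (fun w => X t w * X t.+1 w) by exact: X_mul.
have [|i2 e2] := @X_eps_uncorrelated t t.+1; first by rewrite t1 leqnSn.
rewrite (@eq_esp _ _ _ _ _ (fun w => a * (X t w * X t.+1 w) + X t w * eps t.+2 w)); last first.
  by move=> w; rewrite (XS _ (ltn0Sn t))//; ring.
by rewrite espD//; [rewrite espZ// esp_X_X1// e2 addr0 expr2 mulrA|exact: rintZ].
Qed.

Lemma esp_expR_swap : rint P (fun w => expR (swap_exponent a (sigma ^+ 2) (X 2 w) (X 3 w) (X 4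
  w))) /\
  esp P (fun w => expR (swap_exponent a (sigma ^+ 2) (X 2 w) (X 3 w) (X 4 w))) = 1.
Proof.
apply: ge0_rint.
- by apply: measurable_fun_expR_swap; exact: measurable_funP.
- by move=> w; exact: expR_ge0.
pose f (z : R * R * R) := (expR (swap_exponent a (sigma ^+ 2) z.1.1 z.1.2 z.2))%:E.
rewrite -[LHS]/(\int[P]_w f (X 2 w, X 3 w, X 4 w))%E ge0_integral_triple//; last 2 first.
- by apply/measurable_EFinP; apply: measurable_fun_expR_swap => //; exact: measurableT_comp.
- by move=> z; rewrite lee_fin expR_ge0.
transitivity (\int[N1]_x 1)%E.
  by apply: eq_integral => x _; rewrite /f/= integral_expR_swap.
by rewrite integral_cst// mul1e; exact: (probability_setT N1).
Qed.

(* [X_t] for [t > q] with the contribution of the past up to [X_(q+1)] removed: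
   it depends only on the later innovations. *)
Fixpoint coupled (q u : nat) (w : T) : R :=
  if u is v.+1 then a * coupled q v w + eps (q + v).+2 w else 0.

Lemma X_coupled q u w : X (q + u).+1 w = a ^+ u * X q.+1 w + coupled q u w.
Proof.
elim: u => [|u ih]; first by rewrite addn0 expr0 mul1r addr0.
by rewrite addnS XS// ih /= exprS mulrDr mulrA addrA.
Qed.

Lemma coupled_future q u : sigma_measurable (cylinder xi (fun j => q < j)%N) (coupled q u).
Proof.
elim: u => [|u ih]; first exact: measurable_cst.
apply: measurable_funD; first exact: measurable_funM.
by apply: (@sigma_measurable_coord _ _ _ xi _ (q + u).+1); rewrite ltnS leq_addr.
Qed.

Lemma sigma_measurableW I (U : T -> R) : sigma_measurable (cylinder xi I) U -> measurable_fun
  setT U.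
Proof.
move=> mU _ B mB; have := mU measurableT B mB; apply: smallest_sub.
  exact: sigma_algebra_measurable.
exact: measurable_cylinder.
Qed.

(** * Almost sure averages over blocks of three consecutive values *)

Section ergodic.
Context (h : R * R * R -> R) (C : R) (C0 : 0 <= C) (mh : measurable_fun setT h)
  (lh : quad_lipschitz C h).

Let m := esp P (fun w => h (X 2 w, X 3 w, X 4 w)).
Let H t w := h (X t w, X t.+1 w, X t.+2 w).
Let M := esp N1 (fun x : R => x ^+ 4).
(** Comparison with the origin gives [|h - m| <= c0 + 3 C (x^2 + y^2 + z^2)]. Squaring, with
    [(u + v)^2 <= 2 u^2 + 2 v^2] and its analogue for three terms, gives [K1], where
    [162 = 2 * 9 * 3 * 3]. In [K2], 18 comes from the coupling error and [16 * M] bounds the second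
    moment of its weight. *)
Let c0 := `|h (0, 0, 0)| + `|m|.
Let K1 := 2 * c0 ^+ 2 + 162 * C ^+ 2 * M.
Let K2 := 18 * C * (K1 + 16 * M).

Let mH t : measurable_fun setT (H t).
Proof.
apply: (measurableT_comp mh); apply: measurable_fun_pair => //.
exact: measurable_fun_pair.
Qed.

Let M0 : 0 <= M.
Proof. by apply: esp_ge0 => x; exact: exprn_even_ge0. Qed.

Let h_bound x y z : `|h (x, y, z) - m| <= c0 + 3 * C * (x ^+ 2 + y ^+ 2 + z ^+ 2).
Proof.
have := lh x y z 0 0 0; rewrite !subr0 normr0 !addr0 => hl.
have -> : h (x, y, z) - m = (h (x, y, z) - h (0, 0, 0)) + (h (0, 0, 0) - m) by ring.
apply: le_trans (ler_normD _ _) _; rewrite addrC lerD ?ler_normB//.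
apply: le_trans hl _; rewrite [3 * C]mulrC -mulrA ler_wpM2l//.
rewrite -(real_normK (num_real x)) -(real_normK (num_real y)) -(real_normK (num_real z)).
move: `|x| `|y| `|z| => u v t.
have := sqr_ge0 (u - v); have := sqr_ge0 (u - t); have := sqr_ge0 (v - t); nra.
Qed.

Let c0_ge0 : 0 <= c0. Proof. exact: addr_ge0. Qed.

Let X4t t : (1 <= t)%N -> rint P (fun w => X t w ^+ 4) /\ esp P (fun w => X t w ^+ 4) = M.
Proof. exact: X_pow4. Qed.

Let HmE t (t1 : (1 <= t)%N) : rint P (fun w => H t w - m) /\ esp P (fun w => H t w - m) = 0.
Proof.
have i1 u : (1 <= u)%N -> rint P (fun w => X u w ^+ 2) by move=> u1; exact: (X_sqr u1).1.
have i2 : rint P (fun w => c0 + 3 * C * (X t w ^+ 2 + X t.+1 w ^+ 2 + X t.+2 w ^+ 2)).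
  by apply: rintD; [exact: rint_cst|apply/rintZ/rintD; [apply: rintD|]; exact: i1].
have iHm : rint P (fun w => H t w - m).
  by apply: (rint_dom i2); [exact: measurable_funB|move=> w; exact: h_bound].
split=> //.
have iH : rint P (H t).
  have := rintD iHm (rint_cst P m); congr (rint _ _).
  by apply/funext => w; rewrite subrK.
by rewrite espB//; [rewrite esp_cst /H triple_stationary// subrr|exact: rint_cst].
Qed.

Lemma rint_triple t : (1 <= t)%N -> rint P (H t).
Proof.
move=> t1; have := rintD (HmE t1).1 (rint_cst P m); congr (rint _ _).
by apply/funext => w; rewrite subrK.
Qed.

Let Hsqr t (t1 : (1 <= t)%N) : rint P (fun w => (H t w - m) ^+ 2) /\
  esp P (fun w => (H t w - m) ^+ 2) <= K1.
Proof.
have [ix ex] := X4t t1; have [iy ey] := @X4t t.+1 isT; have [iz ez] := @X4t t.+2 isT.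
have i3 := rintD (rintD ix iy) iz.
have i2 := rintD (rint_cst P (2 * c0 ^+ 2)) (rintZ (54 * C ^+ 2) i3).
have key x y z : (h (x, y, z) - m) ^+ 2 <= 2 * c0 ^+ 2 + 54 * C ^+ 2 * (x ^+ 4 + y ^+ 4 + z ^+ 4).
  rewrite -(real_normK (num_real (h _ - m))).
  apply: (@le_trans _ _ ((c0 + 3 * C * (x ^+ 2 + y ^+ 2 + z ^+ 2)) ^+ 2)).
    by rewrite ler_pXn2r ?nnegrE//; exact: le_trans (h_bound x y z).
  apply: (@le_trans _ _ (2 * c0 ^+ 2 + 2 * (3 * C * (x ^+ 2 + y ^+ 2 + z ^+ 2)) ^+ 2)).
    by have := sqr_ge0 (c0 - 3 * C * (x ^+ 2 + y ^+ 2 + z ^+ 2)); nra.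
  rewrite lerD2l !exprMn (_ : 54 * C ^+ 2 * _ = 2 * (3 ^+ 2 * C ^+ 2 * (3 * (x ^+ 4 + y ^+ 4 + z
    ^+ 4)))); last by ring.
  rewrite ler_wpM2l// ler_wpM2l ?mulr_ge0 ?sqr_ge0//.
  have := sqr_ge0 (x ^+ 2 - y ^+ 2); have := sqr_ge0 (x ^+ 2 - z ^+ 2); have := sqr_ge0 (y ^+ 2 -
    z ^+ 2).
  nra.
have iH2 : rint P (fun w => (H t w - m) ^+ 2).
  apply: (rint_dom i2); first by apply: measurable_funX; exact: measurable_funB.
  by move=> w; rewrite ger0_norm ?sqr_ge0//; exact: key.
split=> //; apply: le_trans (le_esp iH2 i2 (fun w => key _ _ _)) _.
rewrite espD//; [|exact: rint_cst|exact: rintZ].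
rewrite esp_cst espZ// espD//; last exact: rintD.
by rewrite espD// ex ey ez /K1 lerD2l; rewrite le_eqVlt; apply/orP; left; apply/eqP; ring.
Qed.

(** The earlier block ends at [X t.+2] and the later one starts [u] steps after it, so [u = 0] is
    the case of a shared endpoint. The coupling removes the contribution of [X t.+2], whose square
    therefore enters the weight. *)
Let Q t u w := X t.+2 w ^+ 2 + (X (t.+1 + u).+1 w ^+ 2 + X (t.+1 + u).+2 w ^+ 2 + X (t.+1 + u).+3
  w ^+ 2).
Let Hc t u w := h (coupled t.+1 u w, coupled t.+1 u.+1 w, coupled t.+1 u.+2 w).

Let diff_bound t u w : `|H (t.+1 + u).+1 w - Hc t u w| <= `|a| ^+ u * (18 * C * Q t u w).
Proof.
rewrite /H /Hc /Q; have := lh (X (t.+1 + u).+1 w) (X (t.+1 + u).+2 w) (X (t.+1 + u).+3 w)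
  (coupled t.+1 u w) (coupled t.+1 u.+1 w) (coupled t.+1 u.+2 w).
have e1 := X_coupled t.+1 u w.
have e2 := X_coupled t.+1 u.+1 w; have e3 := X_coupled t.+1 u.+2 w.
rewrite !addnS in e2 e3.
move: (X (t.+1 + u).+1 w) (X (t.+1 + u).+2 w) (X (t.+1 + u).+3 w) (X t.+2 w)
  (coupled t.+1 u w) (coupled t.+1 u.+1 w) (coupled t.+1 u.+2 w) e1 e2 e3 => x y z p x' y' z' e1
    e2 e3.
move=> hl; apply: le_trans hl _.
have r0 : 0 <= `|a| ^+ u by exact: exprn_ge0.
have au : `|a ^+ u| = `|a| ^+ u by rewrite normrX.
have dx : `|x - x'| <= `|a| ^+ u * `|p| by rewrite e1 addrK normrM au.
have dy : `|y - y'| <= `|a| ^+ u * `|p|.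
  by rewrite e2 addrK normrM normrX exprS -mulrA ler_piMl ?mulr_ge0// ltW.
have dz : `|z - z'| <= `|a| ^+ u * `|p|.
  rewrite e3 addrK normrM normrX (_ : `|a| ^+ u.+2 * `|p| = `|a| * `|a| * (`|a| ^+ u * `|p|));
    last first.
    by rewrite !exprS !mulrA.
  rewrite ler_piMl ?mulr_ge0//.
  by rewrite mulr_ile1// ltW.
have ru1 : `|a| ^+ u * `|p| <= `|p| by rewrite ler_piMl// exprn_ile1// ltW.
have nx : `|x'| <= `|x| + `|p|.
  have -> : x' = x - (x - x') by ring.
  by apply: le_trans (ler_normB _ _) _; rewrite lerD2l (le_trans dx).
have ny : `|y'| <= `|y| + `|p|.
  have -> : y' = y - (y - y') by ring.
  by apply: le_trans (ler_normB _ _) _; rewrite lerD2l (le_trans dy).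
have nz : `|z'| <= `|z| + `|p|.
  have -> : z' = z - (z - z') by ring.
  by apply: le_trans (ler_normB _ _) _; rewrite lerD2l (le_trans dz).
(* Each coordinate moves by at most [|a|^u |p|], and each coupled coordinate exceeds the true one in
   size by at most [|p|]. The products that remain are bounded by [2 |x| |p| <= x^2 + p^2] and its
   analogues, whence [18 = 3 * 6]. *)
apply: (@le_trans _ _ (C * ((3 * (`|a| ^+ u * `|p|)) *
    (2 * (`|x| + `|y| + `|z|) + 3 * `|p|)))).
  rewrite ler_wpM2l// ler_pM ?addr_ge0//.
    by move: (`|a| ^+ u * `|p|) dx dy dz => b; lra.
  by lra.
rewrite [X in X <= _](_ : _ = `|a| ^+ u * (3 * C * (`|p| * (2 * (`|x| + `|y| + `|z|) + 3 *
  `|p|)))); last by ring.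
rewrite ler_wpM2l// (_ : 18 * C * _ = 3 * C * (6 * (p ^+ 2 + (x ^+ 2 + y ^+ 2 + z ^+ 2)))); last
  by ring.
rewrite ler_wpM2l ?mulr_ge0//.
rewrite -(real_normK (num_real x)) -(real_normK (num_real y)) -(real_normK (num_real z))
  -(real_normK (num_real p)).
move: `|x| `|y| `|z| `|p| => b1 b2 b3 b.
have := sqr_ge0 (b1 - b); have := sqr_ge0 (b2 - b); have := sqr_ge0 (b3 - b).
have := sqr_ge0 b1; have := sqr_ge0 b2; have := sqr_ge0 b3; nra.
Qed.

Let Q_int t u : rint P (Q t u).
Proof.
have i1 v : (1 <= v)%N -> rint P (fun w => X v w ^+ 2) by move=> v1; exact: (X_sqr v1).1.
by apply: rintD; [exact: i1|apply: rintD; [apply: rintD|]; exact: i1].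
Qed.

Let Q_sqr t u : rint P (fun w => Q t u w ^+ 2) /\ esp P (fun w => Q t u w ^+ 2) <= 16 * M.
Proof.
have [ip ep] := @X4t t.+2 isT; have [ix ex] := @X4t (t.+1 + u).+1 isT.
have [iy ey] := @X4t (t.+1 + u).+2 isT; have [iz ez] := @X4t (t.+1 + u).+3 isT.
have i3 := rintD (rintD ix iy) iz; have i4 := rintD ip i3; have i2 := rintZ 4 i4.
have key w : Q t u w ^+ 2 <= 4 * (X t.+2 w ^+ 4 + (X (t.+1 + u).+1 w ^+ 4 + X (t.+1 + u).+2 w ^+
  4 + X (t.+1 + u).+3 w ^+ 4)).
  rewrite /Q -![_ ^+ 4]/(_ ^+ (2 * 2)) !exprM.
  move: (_ ^+ 2) (X (t.+1 + u).+1 w ^+ 2) (X (t.+1 + u).+2 w ^+ 2) (X (t.+1 + u).+3 w ^+ 2) => p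
    x y z.
  have := sqr_ge0 (p - x); have := sqr_ge0 (p - y); have := sqr_ge0 (p - z).
  have := sqr_ge0 (x - y); have := sqr_ge0 (x - z); have := sqr_ge0 (y - z); nra.
have iQ2 : rint P (fun w => Q t u w ^+ 2).
  apply: (rint_dom i2); first by apply: measurable_funX; exact/rint_measurable/Q_int.
  by move=> w; rewrite ger0_norm ?sqr_ge0//; exact: key.
split=> //; apply: le_trans (le_esp iQ2 i2 key) _.
rewrite espZ// espD// espD//; last exact: rintD.
by rewrite espD// ep ex ey ez le_eqVlt; apply/orP; left; apply/eqP; ring.
Qed.

(* Replacing the second block by its coupled version makes it independent of the
   first one, at an L^2 cost of order [|a|^u]. *)
Lemma coupling_cov t u : (1 <= t)%N ->
  `|esp P (fun w => (H t w - m) * (H (t.+1 + u).+1 w - m))| <= K2 * `|a| ^+ u.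
Proof.
move=> t1; pose Y w := H t w - m; pose Z w := Hc t u w - m; pose D w := H (t.+1 + u).+1 w - Hc t
  u w.
have [iY eY] := HmE t1; have [iY2 eY2] := Hsqr t1.
have [iH _] := @HmE (t.+1 + u).+1 isT; have [iH2 _] := @Hsqr (t.+1 + u).+1 isT.
have [iQ2 eQ2] := Q_sqr t u.
have sHc : sigma_measurable (cylinder xi (fun j => t.+1 < j)%N) Z.
  apply: measurable_funB => //; apply: (measurableT_comp mh).
  by apply: measurable_fun_pair; [apply: measurable_fun_pair|]; exact: coupled_future.
have sX v : (1 <= v <= t.+2)%N -> sigma_measurable (cylinder xi (fun j => j <= t.+1)%N) (X v).
  by case: v => // v /andP[_ vt]; exact: past_measurable.
have sY : sigma_measurable (cylinder xi (fun j => j <= t.+1)%N) Y.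
  apply: measurable_funB => //; apply: (measurableT_comp mh).
  apply: measurable_fun_pair; last exact: past_measurable.
  apply: measurable_fun_pair; last exact: past_measurable.
  by apply: sX; rewrite t1 leqW.
have mY : measurable_fun setT Y := sigma_measurableW sY.
have mZ : measurable_fun setT Z := sigma_measurableW sHc.
have mD : measurable_fun setT D.
  rewrite (_ : D = fun w => (H (t.+1 + u).+1 w - m) - Z w); last by apply/funext => w; rewrite
    /D/Z; ring.
  by apply: measurable_funB => //; exact: measurable_funB.
have iD : rint P D.
  by apply: (rint_dom (rintZ (`|a| ^+ u) (rintZ (18 * C) (Q_int t u)))) => // w; exact: diff_bound.
have r0 : 0 <= `|a| ^+ u by exact: exprn_ge0.
have YD w : `|Y w * D w| <= `|a| ^+ u * (18 * C * (Y w ^+ 2 + Q t u w ^+ 2)).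
  rewrite normrM; apply: le_trans (ler_wpM2l (normr_ge0 _) (diff_bound t u w)) _.
  rewrite mulrCA ler_wpM2l// mulrCA ler_wpM2l ?mulr_ge0//.
  rewrite -(real_normK (num_real (Y w))); move: `|Y w| (Q t u w) => y q.
  have := sqr_ge0 (y - q); have := sqr_ge0 y; have := sqr_ge0 q; nra.
have iB := rintZ (`|a| ^+ u) (rintZ (18 * C) (rintD iY2 iQ2)).
have iYD : rint P (fun w => Y w * D w).
  by apply: (rint_dom iB) => //; exact: measurable_funM.
have iYH : rint P (fun w => Y w * (H (t.+1 + u).+1 w - m)).
  by apply: rint_mul => //; exact: measurable_funB.
have iZ : rint P Z.
  by have := rintB iH iD; congr (rint _ _); apply/funext => w; rewrite /Z/D; ring.
have iYZ : rint P (fun w => Y w * Z w).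
  by have := rintB iYH iYD; congr (rint _ _); apply/funext => w; rewrite /Z/D; ring.
pose Ym : {mfun T >-> R} := HB.pack Y (isMeasurableFun.Build _ _ _ _ _ mY).
pose Zm : {mfun T >-> R} := HB.pack Z (isMeasurableFun.Build _ _ _ _ _ mZ).
have YZ : indep_fun P Ym Zm by exact: (@past_future_indep t.+1).
(* The mean of the coupled block [Z] is unknown, but [Y] is centred, so the product of the means
   vanishes. *)
have eYZ : esp P (fun w => Y w * Z w) = 0.
  by have := indep_espM YZ iY iZ iYZ => ->; rewrite [esp P Ym]eY mul0r.
rewrite (@eq_esp _ _ _ _ _ (fun w => Y w * Z w + Y w * D w)); last first.
  by move=> w; rewrite -mulrDr /Z/D/Y; congr (_ * _); ring.
rewrite espD// eYZ add0r.
apply: le_trans (le_norm_esp iYD) _.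
apply: le_trans (le_esp (rint_norm iYD) iB YD) _.
rewrite espZ ?espZ ?espD//; [|exact: rintD|exact/rintZ/rintD].
by rewrite mulrC ler_wpM2r// /K2 ler_wpM2l ?mulr_ge0// lerD.
Qed.

Lemma ergodic_average : {ae P, forall w,
  (\sum_(0 <= k < n) h (X k.*2.+2 w, X k.*2.+3 w, X k.*2.+4 w)) / n%:R @[n --> \oo] --> m}.
Proof.
have asq : 0 <= a ^+ 2 < 1 by rewrite sqr_ge0 -subr_gt0 a2.
have K10 : 0 <= K1 by have [_] := @Hsqr 1 isT; apply: le_trans; apply: esp_ge0 => w; exact: sqr_ge0.
have K20 : 0 <= K2 by rewrite !mulr_ge0// addr_ge0// mulr_ge0.
have := @strong_law_mixing _ _ _ P (fun k w => H k.*2.+2 w - m) (K1 + K2) (a ^+ 2) asq.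
move=> /(_ _ _ _ _)/wrap[].
- by move=> n; exact: measurable_funB.
- by move=> n; exact: (Hsqr _).1.
- by move=> n; rewrite (le_trans (Hsqr _).2)// lerDl.
(* Block [i] ends at time [2 i + 4] and block [j] starts at [2 j + 2]: the lag is [2 (j - i - 1)],
   which makes the mixing rate [a ^+ 2]. *)
- move=> i j ij; have := @coupling_cov i.*2.+2 (j - i.+1).*2 isT.
  have -> : ((i.*2.+2).+1 + (j - i.+1).*2).+1 = j.*2.+2.
    by rewrite -{2}(subnKC ij) doubleD doubleS !addSn.
  move=> /le_trans; apply.
  rewrite -mul2n exprM real_normK ?num_real// ler_wpM2r ?lerDr//.
  exact/exprn_ge0/sqr_ge0.
apply: filterS => w /(cvgD (cvg_cst m)); rewrite addr0; apply: cvg_trans.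
apply: near_eq_cvg; near=> n.
have n0 : (n%:R : R) != 0 by rewrite pnatr_eq0 -lt0n; near: n; exists 1%N.
rewrite fctE sumrB sumr_const_nat subn0 -mulr_natl.
rewrite -[\sum_(0 <= i < n) H i.*2.+2 w]/(\sum_(0 <= k < n) h (X k.*2.+2 w, X k.*2.+3 w, X
  k.*2.+4 w)).
by move: (\sum_(_ <= _ < _) _) => S; field.
Unshelve. all: by end_near.
Qed.

End ergodic.

End autoregression.

(** * Scores and plug-in estimates *)

Section scores.
Context {R : realType}.

Definition log_score (u : R) : R := ln 2 - ln (1 + expR u).

Lemma ar_density_gt0 (a s2 x y z : R) : 0 < s2 -> 0 < ar_density a s2 x y z.
Proof. by move=> s20; rewrite mulr_gt0 ?expR_gt0// invr_gt0 !mulr_gt0// pi_gt0. Qed.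

Lemma ar_density_swap (a s2 x y z : R) : 0 < s2 ->
  ar_density a s2 x z y = ar_density a s2 x y z * expR (swap_exponent a s2 x y z).
Proof.
move=> s20; rewrite /ar_density -[RHS]mulrA -expRD; congr (_ * expR _).
by rewrite /swap_exponent; field; rewrite gt_eqF.
Qed.

Lemma pair_scoreE (a s2 x y z : R) : 0 < s2 ->
  pair_score a s2 x y z = 2 / (1 + expR (swap_exponent a s2 x y z)).
Proof.
move=> s20; rewrite /pair_score (ar_density_swap a x y z s20).
have f0 := ar_density_gt0 a x y z s20.
have e0 := expR_gt0 (swap_exponent a s2 x y z).
move: (ar_density _ _ _ _ _) (expR _) f0 e0 => f e f0 e0.
by field; rewrite ?(gt_eqF f0) ?(gt_eqF (addr_gt0 ltr01 e0)) ?(gt_eqF (addr_gt0 f0 (mulr_gt0 f0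
  e0))).
Qed.

Lemma pair_score_gt0 (a s2 x y z : R) : 0 < s2 -> 0 < pair_score a s2 x y z.
Proof. by move=> s20; rewrite pair_scoreE// divr_gt0// addr_gt0 ?expR_gt0. Qed.

Lemma ln_pair_score (a s2 x y z : R) : 0 < s2 ->
  ln (pair_score a s2 x y z) = log_score (swap_exponent a s2 x y z).
Proof. by move=> s20; rewrite pair_scoreE// ln_div ?posrE ?addr_gt0 ?expR_gt0. Qed.

(** For [u <= v] one has [1 + exp v <= exp (v - u) (1 + exp u)]; take logarithms. *)
Lemma log_score_lipschitz (u v : R) : `|log_score u - log_score v| <= `|u - v|.
Proof.
wlog uv : u v / u <= v.
  move=> H; have /orP[uv|vu] := le_total u v; first exact: H.
  by rewrite distrC [leRHS]distrC; exact: H.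
have p w : 0 < 1 + expR w :> R by rewrite addr_gt0 ?expR_gt0.
rewrite (_ : log_score u - log_score v = ln (1 + expR v) - ln (1 + expR u)); last first.
  by rewrite /log_score; ring.
rewrite [leRHS]distrC [leRHS]ger0_norm ?subr_ge0//.
rewrite ger0_norm; last by rewrite subr_ge0 ler_ln ?posrE// lerD2l ler_expR.
rewrite lerBlDr -[v - u]expRK -lnM ?posrE ?expR_gt0//.
rewrite ler_ln ?posrE ?mulr_gt0 ?expR_gt0// mulrDr mulr1 -expRD subrK lerD2r.
by rewrite -expR0 ler_expR subr_ge0.
Qed.

Lemma log_score0 : log_score 0 = 0.
Proof. by rewrite /log_score expR0 subrr. Qed.

(** This is [ln z <= z - 1] at [z = (1 + exp u) / 2], with equality only at [z = 1]. *)
Lemma log_score_ge (u : R) : (1 - expR u) / 2 <= log_score u ?= iff (u == 0).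
Proof.
have p : 0 < (1 + expR u) / 2 :> R by rewrite divr_gt0// addr_gt0 ?expR_gt0.
have E : log_score u = - ln ((1 + expR u) / 2).
  by rewrite /log_score ln_div ?posrE ?addr_gt0 ?expR_gt0// opprB.
have E2 : (1 - expR u) / 2 = - ((1 + expR u) / 2 - 1) by field.
split.
  rewrite E E2 lerN2 lerBrDl -[X in _ <= X](lnK p).
  exact: expR_ge1Dx.
apply/eqP/eqP => [|->]; last by rewrite log_score0 expR0 subrr mul0r.
rewrite E E2 => /oppr_inj e; apply/eqP; apply: contraTT isT => u0.
have : ln ((1 + expR u) / 2) != 0.
  rewrite ln_eq0//; apply: contra u0 => /eqP e1.
  by rewrite -(expRK u) ln_eq0 ?expR_gt0//; apply/eqP; lra.
by move/expR_gt1Dx; rewrite (lnK p) -e addrC subrK ltxx.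
Qed.

Lemma quad_lipschitz_mul (p q p' q' D N : R) :
  `|p - p'| <= D -> `|q - q'| <= D -> `|q| + `|p'| <= N -> `|p * q - p' * q'| <= D * N.
Proof.
move=> pD qD qN; have -> : p * q - p' * q' = (p - p') * q + p' * (q - q') by ring.
apply: le_trans (ler_normD _ _) _; rewrite !normrM.
apply: (@le_trans _ _ (D * (`|q| + `|p'|))).
  by rewrite mulrDr lerD// ?ler_wpM2r// mulrC ler_wpM2r.
by rewrite ler_wpM2l// (le_trans _ pD).
Qed.

Lemma quad_lipschitzD (C1 C2 : R) (h1 h2 : R * R * R -> R) :
  quad_lipschitz C1 h1 -> quad_lipschitz C2 h2 -> quad_lipschitz (C1 + C2) (fun v => h1 v + h2 v).
Proof.
move=> l1 l2 x y z x' y' z'; rewrite mulrDl opprD addrACA.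
by apply: le_trans (ler_normD _ _) _; rewrite lerD.
Qed.

Lemma quad_lipschitzZ (C c : R) (h : R * R * R -> R) :
  quad_lipschitz C h -> quad_lipschitz (`|c| * C) (fun v => c * h v).
Proof. by move=> l x y z x' y' z'; rewrite -mulrBr normrM -mulrA ler_wpM2l. Qed.

Lemma quad_lipschitz_log_score (C : R) (h : R * R * R -> R) :
  quad_lipschitz C h -> quad_lipschitz C (fun v => log_score (h v)).
Proof.
by move=> l x y z x' y' z'; apply: le_trans (log_score_lipschitz _ _) (l _ _ _ _ _ _).
Qed.

Lemma quad_lipschitz_monomials :
  [/\ quad_lipschitz 1 (fun v : R * R * R => v.1.1 * v.1.1),
      quad_lipschitz 1 (fun v : R * R * R => v.1.2 * v.1.2),
      quad_lipschitz 1 (fun v : R * R * R => v.2 * v.2),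
      quad_lipschitz 1 (fun v : R * R * R => v.1.1 * v.1.2) &
      quad_lipschitz 1 (fun v : R * R * R => v.1.1 * v.2) /\
      quad_lipschitz 1 (fun v : R * R * R => v.1.2 * v.2)].
Proof.
have nn (u : R) := normr_ge0 u.
by split; [| | | |split] => x y z x' y' z' /=; rewrite mul1r; apply: quad_lipschitz_mul;
  have := nn (x - x'); have := nn (y - y'); have := nn (z - z');
  have := nn x; have := nn y; have := nn z;
  have := nn x'; have := nn y'; have := nn z'; lra.
Qed.

Lemma quad_lipschitz_swap (a s2 : R) : exists2 C, 0 <= C &
  quad_lipschitz C (fun v => swap_exponent a s2 v.1.1 v.1.2 v.2).
Proof.
have [_ ly lz lxy [lxz _]] := quad_lipschitz_monomials.
have l1 := quad_lipschitzZ (a ^+ 2 / (2 * s2)) (quad_lipschitzD ly (quad_lipschitzZ (-1) lz)).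
have l2 := quad_lipschitzZ (- (a / s2)) (quad_lipschitzD lxy (quad_lipschitzZ (-1) lxz)).
have := quad_lipschitzD l1 l2; set C := (X in quad_lipschitz X) => l.
exists C; first by rewrite !(addr_ge0, mulr_ge0).
move=> x y z x' y' z'; have := l x y z x' y' z'; congr (`|_| <= _).
by rewrite /swap_exponent/=; ring.
Qed.

End scores.

(** * Consistency of the estimates and the plug-in error along one path *)

Section plug_in.
Context {R : realType}.

(** A Toeplitz argument. The weights [q k] may be unbounded, so [e k] need not tend to 0; only the
    averages of [q] are controlled. Beyond some rank [d k] is at most [e'], chosen so that
    [e' (L + 1)] is half the tolerance, and the finitely many earlier terms vanish after division by
    [n]. *)
Lemma cvg_weighted_mean0 (e d q : nat -> R) (L : R) :
  (forall k, 0 <= q k) -> d k @[k --> \oo] --> (0 : R) ->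
  (\sum_(0 <= k < n) q k) / n%:R @[n --> \oo] --> L ->
  (\forall k \near \oo, `|e k| <= d k * q k) ->
  (\sum_(0 <= k < n) e k) / n%:R @[n --> \oo] --> (0 : R).
Proof.
move=> q0 d0 qL [N1 _ eN]; apply/cvgrPdist_le => eps eps0.
have L0 : 0 <= L.
  rewrite -(cvg_lim _ qL)//; apply: limr_ge; first by apply/cvg_ex; exists L.
  apply: nearW => n.
  by rewrite divr_ge0// sumr_ge0.
pose e' := eps / 2 / (L + 1).
have e'0 : 0 < e' by rewrite !divr_gt0// ltr_wpDl.
have [N2 _ dN] := (cvgrPdist_le _ _).1 d0 _ e'0.
have [N3 _ qN] := (cvgrPdist_le _ _).1 qL 1 ltr01.
pose N := maxn N1 N2.
pose E := \sum_(0 <= k < N) `|e k|.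
have E0 : 0 <= E by exact: sumr_ge0.
exists (maxn (maxn N N3) (Num.truncn (E / (eps / 2))).+1) => // n /=.
rewrite geq_max => /andP[]; rewrite geq_max => /andP[Nn N3n] En.
have n0 : 0 < (n%:R : R) by rewrite ltr0n (leq_trans _ En).
rewrite sub0r normrN normrM normfV (gtr0_norm n0) ler_pdivrMr//.
apply: le_trans (ler_norm_sum _ _ _) _.
rewrite (big_cat_nat (leq0n N) Nn)/= [eps]splitr mulrDl lerD//.
  have : E / (eps / 2) <= n%:R.
    by apply/ltW; rewrite (lt_le_trans (truncnS_gt _))// ler_nat.
  by rewrite ler_pdivrMr ?divr_gt0// mulrC.
have qn : \sum_(0 <= k < n) q k <= (L + 1) * n%:R.
  rewrite -ler_pdivrMr//; have := qN n N3n.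
  by rewrite /= distrC ler_norml => /andP[_]; rewrite lerBlDl addrC.
apply: (@le_trans _ _ (e' * \sum_(0 <= k < n) q k)); last first.
  apply: le_trans (ler_wpM2l (ltW e'0) qn) _.
  by rewrite mulrA /e' divfK// gt_eqF// ltr_wpDl.
rewrite (big_cat_nat (leq0n N) Nn)/= mulrDr ler_wpDl//.
  by apply: mulr_ge0; [exact: ltW|exact: sumr_ge0].
rewrite mulr_sumr big_nat [leRHS]big_nat; apply: ler_sum => k /andP[Nk _].
move: Nk; rewrite geq_max => /andP[/eN ek /dN dk].
apply: le_trans ek _; rewrite ler_wpM2r//; apply: le_trans (ler_norm _) _.
by have := dk; rewrite /= sub0r normrN.
Qed.

Lemma cvg_natrV : (n%:R^-1 : R) @[n --> \oo] --> (0 : R).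
Proof. by rewrite -cvg_shiftS; exact: cvg_harmonic. Qed.

Lemma cvg_cst_mean0 (c : R) : (c / n%:R) @[n --> \oo] --> (0 : R).
Proof. by rewrite -(mulr0 c); apply: cvgM; [exact: cvg_cst|exact: cvg_natrV]. Qed.

Lemma cvg_mean_addcst (c l : R) (S : nat -> R) : S n / n%:R @[n --> \oo] --> l ->
  (c + S n) / n%:R @[n --> \oo] --> l.
Proof.
move=> Sl; rewrite -[l]add0r; under eq_cvg do rewrite mulrDl.
by apply: cvgD => //; exact: cvg_cst_mean0.
Qed.

(** The estimators sum over all times while the blocks advance by two. Pairing consecutive terms,
    with one boundary term left over, turns the former into block sums. *)
Lemma sum_nat_pairs (F : nat -> R) p k :
  \sum_(p <= i < p.+1 + k.*2) F i = F p + \sum_(0 <= j < k) (F (p.+1 + j.*2)%N + F (p.+2 + j.*2)%N).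
Proof.
elim: k => [|k ih]; first by rewrite addn0 big_nat1 big_geq// addr0.
have h1 : (p <= p.+1 + k.*2)%N by lia.
rewrite doubleS !addnS big_nat_recr/=; last exact: leqW.
rewrite big_nat_recr//= ih [in RHS]big_nat_recr//=.
by rewrite !addSn -!addrA.
Qed.

(* [Shat] at the odd time [t = 2k+3] is estimated from the first [m = 2k+2] values. *)
Lemma ln_wealth (x : nat -> R) n :
  ln (wealth x n.+1) = \sum_(0 <= k < n) ln (Shat x k.*2.+3).
Proof.
have Shat_gt0 t : 0 < Shat x t.
  rewrite /Shat; case: ifPn => //; rewrite negb_or -ltNge => /andP[_ h].
  exact: pair_score_gt0.
have wealth_gt0 m : 0 < wealth x m.
  by elim: m => // -[|m] ih //; rewrite -[X in 0 < X]/(wealth x m.+1 * _) mulr_gt0.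
elim: n => [|n ih]; first by rewrite big_geq// ln1.
rewrite big_nat_recr//= -ih -lnM ?posrE//.
Qed.

(** Expanding the residual sum of squares expresses [s2hat] through [ahat] and three sums, each a
    boundary term plus a sum over blocks, so block averages determine all the limits. *)
Lemma plug_in_estimates (x : nat -> R) k : let m := k.*2.+2 in
  [/\ ahat_den x m = x 1%N ^+ 2 + \sum_(0 <= j < k) (x j.*2.+2 ^+ 2 + x j.*2.+3 ^+ 2),
      ahat x m = (x 2 * x 1%N + \sum_(0 <= j < k) (x j.*2.+2 * x j.*2.+3 + x j.*2.+3 * x
        j.*2.+4)) / ahat_den x m &
      s2hat x m = (k.*2.+1)%:R^-1 * ((x 2 ^+ 2 + \sum_(0 <= j < k) (x j.*2.+3 ^+ 2 + x j.*2.+4 ^+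
        2))
        - 2 * ahat x m * (x 2 * x 1%N + \sum_(0 <= j < k) (x j.*2.+2 * x j.*2.+3 + x j.*2.+3 * x
          j.*2.+4))
        + ahat x m ^+ 2 * ahat_den x m)].
Proof.
move=> m.
have E1 : ahat_den x m = x 1%N ^+ 2 + \sum_(0 <= j < k) (x j.*2.+2 ^+ 2 + x j.*2.+3 ^+ 2).
  by rewrite /ahat_den -[m]/(2 + k.*2)%N sum_nat_pairs.
have E2 : \sum_(2 <= i < m.+1) x i * x i.-1 =
    x 2 * x 1%N + \sum_(0 <= j < k) (x j.*2.+2 * x j.*2.+3 + x j.*2.+3 * x j.*2.+4).
  rewrite -[m.+1]/(3 + k.*2)%N sum_nat_pairs; congr (_ + _).
  by apply: eq_bigr => j _; rewrite [x (3 + _)%N * _]mulrC [x (4 + _)%N * _]mulrC.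
have E3 : \sum_(2 <= i < m.+1) x i ^+ 2 =
    x 2 ^+ 2 + \sum_(0 <= j < k) (x j.*2.+3 ^+ 2 + x j.*2.+4 ^+ 2).
  by rewrite -[m.+1]/(3 + k.*2)%N sum_nat_pairs.
have E4 : \sum_(2 <= i < m.+1) x i.-1 ^+ 2 = ahat_den x m.
  by rewrite big_add1/=.
split=> //; first by rewrite /ahat E2.
rewrite /s2hat -E2 -E3 -E4; congr (_ * _).
rewrite !mulr_sumr -sumrB -big_split/=; apply: eq_bigr => i _.
ring.
Qed.

Lemma wealth_growth (x : nat -> R) (a s sigma r : R) : s != 0 -> 0 < sigma ->
  sigma ^+ 2 = (1 - a ^+ 2) * s ^+ 2 ->
  (\sum_(0 <= k < n) (x k.*2.+2 ^+ 2 + x k.*2.+3 ^+ 2)) / n%:R @[n --> \oo] --> 2 * s ^+ 2 ->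
  (\sum_(0 <= k < n) (x k.*2.+3 ^+ 2 + x k.*2.+4 ^+ 2)) / n%:R @[n --> \oo] --> 2 * s ^+ 2 ->
  (\sum_(0 <= k < n) (x k.*2.+2 * x k.*2.+3 + x k.*2.+3 * x k.*2.+4)) / n%:R @[n --> \oo] -->
    2 * (a * s ^+ 2) ->
  (\sum_(0 <= k < n) log_score (swap_exponent a (sigma ^+ 2) (x k.*2.+2) (x k.*2.+3) (x k.*2.+4)))
     / n%:R @[n --> \oo] --> 2 * r ->
  ln (wealth x n) / (2 * n%:R) @[n --> \oo] --> r.
Proof.
move=> s0 sigma0 sE H1 H2 H3 H4.
pose m k := k.*2.+2.
pose num k := x 2 * x 1%N + \sum_(0 <= j < k) (x j.*2.+2 * x j.*2.+3 + x j.*2.+3 * x j.*2.+4).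
pose sq k := x 2 ^+ 2 + \sum_(0 <= j < k) (x j.*2.+3 ^+ 2 + x j.*2.+4 ^+ 2).
have dn : ahat_den x (m k) / k%:R @[k --> \oo] --> 2 * s ^+ 2.
  under eq_cvg do rewrite (let: And3 e _ _ := plug_in_estimates x _ in e).
  exact: cvg_mean_addcst.
have nn : num k / k%:R @[k --> \oo] --> 2 * (a * s ^+ 2) by exact: cvg_mean_addcst.
have qn : sq k / k%:R @[k --> \oo] --> 2 * s ^+ 2 by exact: cvg_mean_addcst.
have s2n : 2 * s ^+ 2 != 0 by rewrite mulf_neq0// sqrf_eq0.
have sn : sigma ^+ 2 != 0 by rewrite gt_eqF// exprn_gt0.
have ah : ahat x (m k) @[k --> \oo] --> a.
  have : (num k / k%:R) / (ahat_den x (m k) / k%:R) @[k --> \oo] --> 2 * (a * s ^+ 2) / (2 * s ^+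
    2).
    by apply: cvgM => //; exact: cvgV.
  rewrite (_ : 2 * (a * _) / _ = a); last by field.
  apply: cvg_trans; apply: near_eq_cvg; near=> k.
  have k0 : (k%:R : R) != 0 by rewrite pnatr_eq0 -lt0n; near: k; exists 1%N.
  have [_ -> _] := plug_in_estimates x k; rewrite -/(m k) -/(num k).
  by rewrite invfM invrK mulrACA [_^-1 * k%:R]mulVf// mulr1.
(* [s2hat] divides by the number [2 k + 1] of residuals, whereas the block averages divide by
   [k]. *)
have hf : (k%:R / (k.*2.+1)%:R : R) @[k --> \oo] --> (2^-1 : R).
  have : (2 + k%:R^-1)^-1 @[k --> \oo] --> (2^-1 : R).
    apply: cvgV => //; rewrite -[X in _ --> X]addr0.
    by apply: cvgD; [exact: cvg_cst|exact: cvg_natrV].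
  apply: cvg_trans; apply: near_eq_cvg; near=> k.
  have k0 : 0 < (k%:R : R) by rewrite ltr0n; near: k; exists 1%N.
  have -> : (k.*2.+1%:R : R) = 2 * k%:R + 1 by rewrite -[LHS]natr1 -mul2n natrM.
  move: (k%:R) k0 => K K0.
  by field; rewrite !gt_eqF// ?ltr_wpDr ?mulr_gt0 ?ltr_wpDr// ltW.
have sh : s2hat x (m k) @[k --> \oo] --> sigma ^+ 2.
  have : (k%:R / (k.*2.+1)%:R) * (sq k / k%:R - 2 * ahat x (m k) * (num k / k%:R)
     + ahat x (m k) ^+ 2 * (ahat_den x (m k) / k%:R)) @[k --> \oo] -->
     2^-1 * (2 * s ^+ 2 - 2 * a * (2 * (a * s ^+ 2)) + a ^+ 2 * (2 * s ^+ 2)).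
    apply: cvgM => //; apply: cvgD; last by apply: cvgM => //; rewrite expr2; under eq_cvg do
      rewrite expr2; exact: cvgM.
    apply: cvgB => //; apply: cvgM => //; apply: cvgM => //; exact: cvg_cst.
  (* The limit is [(1 - 2 a^2 + a^2) s^2], the innovation variance by stationarity. *)
  rewrite (_ : 2^-1 * _ = sigma ^+ 2); last by rewrite sE; field.
  apply: cvg_trans; apply: near_eq_cvg; near=> k.
  have k0 : (k%:R : R) != 0 by rewrite pnatr_eq0 -lt0n; near: k; exists 1%N.
  have [_ _ ->] := plug_in_estimates x k; rewrite -/(m k) -/(num k) -/(sq k).
  move: (ahat _ _) (num k) (sq k) (ahat_den _ _) (k.*2.+1%:R^-1) => A B C D E.
  by field.
pose U k := swap_exponent a (sigma ^+ 2) (x k.*2.+2) (x k.*2.+3) (x k.*2.+4).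
(* The error in the two coefficients of the exponent. The leading 2 absorbs the bounds of both
   quadratic forms in the exponent by [2 * q k]. *)
pose d k := 2 * (`|ahat x (m k) ^+ 2 / (2 * s2hat x (m k)) - a ^+ 2 / (2 * sigma ^+ 2)| +
  `|ahat x (m k) / s2hat x (m k) - a / sigma ^+ 2|).
pose q k := x k.*2.+2 ^+ 2 + x k.*2.+3 ^+ 2 + (x k.*2.+3 ^+ 2 + x k.*2.+4 ^+ 2).
have d0 : d k @[k --> \oo] --> (0 : R).
  rewrite -(mulr0 2); apply: cvgM; first exact: cvg_cst.
  rewrite -[X in _ --> X]addr0 -(normr0 R).
  apply: cvgD; apply: cvg_norm; apply/subr_cvg0.
    apply: cvgM; first by rewrite expr2; under eq_cvg do rewrite expr2; exact: cvgM.
    by apply: cvgV; [rewrite mulf_neq0|apply: cvgM => //; exact: cvg_cst].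
  by apply: cvgM => //; exact: cvgV.
have qL : (\sum_(0 <= k < n) q k) / n%:R @[n --> \oo] --> 2 * s ^+ 2 + 2 * s ^+ 2.
  under eq_cvg do rewrite big_split/= mulrDl.
  exact: cvgD.
have close : \forall k \near \oo, `|ln (Shat x k.*2.+3) - log_score (U k)| <= d k * q k.
  (* Both limits are positive, so for large [k] the estimates are non-degenerate and [Shat] is a
     true score instead of its default 1. *)
  have ds : \forall k \near \oo, 0 < s2hat x (m k).
    by apply: (cvgr_gt _ sh); rewrite exprn_gt0.
  have dd : \forall k \near \oo, 0 < ahat_den x (m k) / k%:R.
    by apply: (cvgr_gt _ dn); rewrite mulr_gt0// exprn_even_gt0.
  near=> k.
  have sk : 0 < s2hat x (m k) by near: k.
  have dk : ahat_den x (m k) != 0.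
    have : 0 < ahat_den x (m k) / k%:R by near: k.
    by apply: contraTneq => ->; rewrite mul0r ltxx.
  rewrite /Shat/= -/(m k) (negbTE dk) [s2hat _ _ <= 0]leNgt sk/= ln_pair_score//.
  apply: le_trans (log_score_lipschitz _ _) _.
  rewrite /U /swap_exponent /d /q.
  move: (_ / (2 * s2hat _ _)) (_ / (2 * sigma ^+ 2)) (_ / s2hat _ _) (_ / sigma ^+ 2) => t1 t2 t3
    t4.
  rewrite /m; move: (x k.*2.+2) (x k.*2.+3) (x k.*2.+4) => y1 y2 y3.
  rewrite (_ : _ - _ = (t1 - t2) * (y2 ^+ 2 - y3 ^+ 2) - (t3 - t4) * (y1 * (y2 - y3))); last by
    ring.
  apply: le_trans (ler_normB _ _) _; rewrite (normrM (t1 - t2)) (normrM (t3 - t4)).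
  have b1 : `|y2 ^+ 2 - y3 ^+ 2| <= 2 * (y1 ^+ 2 + y2 ^+ 2 + (y2 ^+ 2 + y3 ^+ 2)).
    by rewrite ler_norml; apply/andP; split; nra.
  have b2 : `|y1 * (y2 - y3)| <= 2 * (y1 ^+ 2 + y2 ^+ 2 + (y2 ^+ 2 + y3 ^+ 2)).
    have := sqr_ge0 (y1 - y2 + y3); have := sqr_ge0 (y1 + y2 - y3).
    have := sqr_ge0 (y2 + y3); have := sqr_ge0 y1; have := sqr_ge0 y2; have := sqr_ge0 y3.
    by move=> *; rewrite ler_norml; apply/andP; split; nra.
  rewrite [X in _ <= X * _]mulrC -mulrA mulrDl; apply: lerD; exact: ler_wpM2l.
have L : (\sum_(0 <= k < n) (ln (Shat x k.*2.+3) - log_score (U k))) / n%:R @[n --> \oo] --> (0 :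
  R).
  apply: (cvg_weighted_mean0 _ d0 qL close) => k.
  by rewrite !addr_ge0// sqr_ge0.
rewrite -cvg_shiftS.
(* [wealth x n.+1] is a product of [n] scores but is normalised by [2 (n + 1)]; the factor
   [n / (2 (n + 1))] tends to [1 / 2]. *)
have : ((\sum_(0 <= k < n) (ln (Shat x k.*2.+3) - log_score (U k))) / n%:R +
  (\sum_(0 <= k < n) log_score (U k)) / n%:R) * (n%:R / (2 * n.+1%:R)) @[n --> \oo] --> (0 + 2 *
    r) * (2^-1 : R).
  apply: cvgM; first exact: cvgD.
  have : 2^-1 * (1 - n.+1%:R^-1) @[n --> \oo] --> (2^-1 * (1 - 0) : R).
    by apply: cvgM; [exact: cvg_cst|apply: cvgB; [exact: cvg_cst|exact: cvg_harmonic]].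
  rewrite subr0 mulr1; apply: cvg_trans; apply: near_eq_cvg; near=> n.
  have n1 : (n.+1%:R : R) != 0 by rewrite pnatr_eq0.
  have -> : (n%:R : R) = n.+1%:R - 1 by rewrite -natr1 addrK.
  by move: (n.+1%:R) n1 => K K0; field.
rewrite add0r mulrAC divff// mul1r; apply: cvg_trans; apply: near_eq_cvg; near=> n.
have n0 : (n%:R : R) != 0 by rewrite pnatr_eq0 -lt0n; near: n; exists 1%N.
rewrite /= ln_wealth sumrB -mulrDl subrK.
by rewrite mulrA divfK.
Unshelve. all: by end_near.
Qed.

End plug_in.

(** * The sign of the growth rate and the conclusion *)

Lemma ae_eq0_of_esp0 (R : realType) d (T : measurableType d) (P : probability T R) (f : T -> R) :
  rint P f -> (forall w, 0 <= f w) -> esp P f = 0 -> {ae P, forall w, f w = 0}.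
Proof.
move=> fi f0 ef.
have mf : measurable_fun setT (EFin \o f) by case/integrableP : fi.
have /(ae_eq_integral_abs P measurableT mf) : (\int[P]_w `|(EFin \o f) w| = 0)%E.
  by under eq_integral do rewrite /= ger0_norm//; rewrite EFin_esp// ef.
by apply: filterS => w /(_ I)[].
Qed.

Lemma esp_ae_eq0 (R : realType) d (T : measurableType d) (P : probability T R) (f : T -> R) :
  rint P f -> {ae P, forall w, f w = 0} -> esp P f = 0.
Proof.
move=> fi f0; have mf : measurable_fun setT (EFin \o f) by case/integrableP : fi.
rewrite /esp /Rintegral (ae_eq_integral (cst 0%E))//; first by rewrite integral0.
by apply: filterS f0 => w /= -> _.
Qed.

Theorem theorem2p5 (R : realType) (d : measure_display) (T : measurableType d)
    (P : probability T R) (a sigma : R) (X eps : nat -> {RV P >-> R}) :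
  `|a| < 1 -> 0 < sigma ->
  (* X_1 ~ N(0, sigma^2/(1-a^2)) : stationary start *)
  (forall A, measurable A ->
     distribution P (X 1%N) A = normal_prob 0 (sigma / Num.sqrt (1 - a ^+ 2)) A) ->
  (* eps_t ~ N(0, sigma^2), t >= 2 *)
  (forall t, (2 <= t)%N -> forall A, measurable A ->
     distribution P (eps t) A = normal_prob 0 sigma A) ->
  (* X_1, eps_2, eps_3, ... mutually independent *)
  mutually_independent P
    (fun k => if k is k'.+1 then (eps k'.+2 : T -> R) else (X 1%N : T -> R)) ->
  (* X_{t+1} = a X_t + eps_{t+1} *)
  (forall t w, (1 <= t)%N -> X t.+1 w = a * X t w + eps t.+1 w) ->
  exists r : R,
    ('E_P[fun w => ln (pair_score a (sigma ^+ 2) (X 2%N w) (X 3%N w) (X 4%N w))]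
       = (2 * r)%:E)%E /\
    0 <= r /\ (r = 0 <-> a = 0) /\
    {ae P, forall w,
       (fun n : nat => ln (wealth (fun t => X t w) n) / (2 * n%:R)) @ \oo --> r}.
Proof.
move=> a1 sigma0 lawX1 lawe indxi XS.
pose s := sigma / Num.sqrt (1 - a ^+ 2).
have a2 : 0 < 1 - a ^+ 2 by rewrite subr_gt0 -real_normK ?num_real// expr_lt1.
have s0 : s != 0 by rewrite gt_eqF// divr_gt0// sqrtr_gt0.
have s20 : 0 < sigma ^+ 2 by rewrite exprn_gt0.
have sE : sigma ^+ 2 = (1 - a ^+ 2) * s ^+ 2 by exact: stationary_variance.
have ergodic := @ergodic_average R d T P a sigma X eps a1 sigma0 lawX1 lawe indxi XS.
have sqrX t : (1 <= t)%N -> rint P (fun w => X t w ^+ 2) /\ esp P (fun w => X t w ^+ 2) = s ^+ 2.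
  by move=> t1; exact: (@X_sqr R d T P a sigma X eps).
have mulX t u : (1 <= t)%N -> (1 <= u)%N -> rint P (fun w => X t w * X u w).
  by move=> t1 u1; exact: (@X_mul R d T P a sigma X eps).
have mulX1 t : (1 <= t)%N -> esp P (fun w => X t w * X t.+1 w) = a * s ^+ 2.
  by move=> t1; exact: (@esp_X_X1 R d T P a sigma X eps).
have mulX2 t : (1 <= t)%N -> esp P (fun w => X t w * X t.+2 w) = a ^+ 2 * s ^+ 2.
  by move=> t1; exact: (@esp_X_X2 R d T P a sigma X eps).
have [lx ly lz lxy [lxz lyz]] := @quad_lipschitz_monomials R.
have m1 : measurable_fun setT (fun v : R * R * R => v.1.1) by exact: measurableT_comp.
have m2 : measurable_fun setT (fun v : R * R * R => v.1.2) by exact: measurableT_comp.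
have m3 : measurable_fun setT (fun v : R * R * R => v.2) by exact: measurable_snd.
have [C C0 lU] := quad_lipschitz_swap a (sigma ^+ 2).
pose U (v : R * R * R) := swap_exponent a (sigma ^+ 2) v.1.1 v.1.2 v.2.
have mU : measurable_fun setT U.
  apply: measurable_funB.
    by apply: measurable_funM => //; apply: measurable_funB; exact: measurable_funX.
  by apply: measurable_funM => //; apply: measurable_funM => //; exact: measurable_funB.
have mlU : measurable_fun setT (fun v => log_score (U v)).
  apply: measurable_funB => //; apply: measurableT_comp; first exact: measurable_ln.
  by apply: measurable_funD => //; exact: measurableT_comp.
have lsU := quad_lipschitz_log_score lU.
have iS := @rint_triple R d T P a sigma X eps a1 sigma0 lawX1 lawe indxi XS _ C C0 mlU lsU 2 isT.
pose V w := (X 2 w, X 3 w, X 4 w).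
have [iE eE] := @esp_expR_swap R d T P a sigma X eps a1 sigma0 lawX1 lawe indxi XS.
pose S := esp P (fun w => log_score (U (V w))).
have iD : rint P (fun w => (1 - expR (U (V w))) / 2).
  have := rintZ 2^-1 (rintB (rint_cst P 1) iE); congr (rint _ _).
  by apply/funext => w; rewrite mulrC.
have eD : esp P (fun w => (1 - expR (U (V w))) / 2) = 0.
  rewrite (@eq_esp _ _ _ _ _ (fun w => 2^-1 * (1 - expR (U (V w))))); last by move=> w; rewrite mulrC.
  rewrite espZ; last exact: (rintB (rint_cst P 1) iE).
  by rewrite espB ?esp_cst; [rewrite [esp _ _]eE subrr mulr0|exact: rint_cst|exact: iE].
have iG := rintB iS iD.
(* [S] is the mean log-score of one bet, and each bet consumes two observations. *)
exists (S / 2); split; last split; last split.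
- rewrite unlock mulrCA divff// mulr1 -EFin_esp//.
  by apply: eq_integral => w _; rewrite ln_pair_score.
- rewrite divr_ge0// -eD; apply: le_esp => // w.
  exact: (log_score_ge _).1.
- split=> [/eqP|a0]; last first.
    rewrite /S (@eq_esp _ _ _ _ _ (fun=> 0)) ?esp_cst ?mul0r// => w.
    by rewrite /U /swap_exponent a0 expr0n/= !mul0r subrr log_score0.
  rewrite mulf_eq0 invr_eq0 pnatr_eq0 orbF => /eqP S0.
  have G0 : {ae P, forall w, log_score (U (V w)) - (1 - expR (U (V w))) / 2 = 0}.
    apply: ae_eq0_of_esp0 => //; first by move=> w; rewrite subr_ge0; exact: (log_score_ge _).1.
    by rewrite espB// eD subr0.
  have iU : rint P (fun w => U (V w)) /\
      esp P (fun w => U (V w)) = a ^+ 2 / (2 * sigma ^+ 2) * (s ^+ 2 - s ^+ 2) -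
        a / sigma ^+ 2 * (a * s ^+ 2 - a ^+ 2 * s ^+ 2).
    have [iy ey] := sqrX 3 isT; have [iz ez] := sqrX 4 isT.
    have ixy := mulX 2 3 isT isT; have ixz := mulX 2 4 isT isT.
    have i1 := rintZ (a ^+ 2 / (2 * sigma ^+ 2)) (rintB iy iz).
    have i2 := rintZ (a / sigma ^+ 2) (rintB ixy ixz).
    have E w : U (V w) = a ^+ 2 / (2 * sigma ^+ 2) * (X 3 w ^+ 2 - X 4 w ^+ 2) -
        a / sigma ^+ 2 * (X 2 w * X 3 w - X 2 w * X 4 w).
      by rewrite /U /V /swap_exponent/= (mulrBr (X 2 w)).
    split; first by have := rintB i1 i2; congr (rint _ _); apply/funext => w; rewrite E.
    rewrite (eq_esp _ E) espB//.
    rewrite espZ ?espZ; [|exact: rintB|exact: rintB].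
    by rewrite espB// espB// ey ez mulX1// mulX2.
  have : esp P (fun w => U (V w)) = 0.
    apply: esp_ae_eq0; first exact: iU.1.
    apply: filterS G0 => w /eqP; rewrite subr_eq0 eq_sym (log_score_ge _).2.
    by move/eqP.
  rewrite iU.2 subrr mulr0 add0r => /eqP; rewrite oppr_eq0.
  rewrite (_ : _ * _ = a ^+ 2 * (1 - a) * s ^+ 2 / sigma ^+ 2); last by ring.
  rewrite mulf_eq0 invr_eq0 (gt_eqF s20) orbF mulf_eq0 sqrf_eq0 (negbTE s0) orbF.
  rewrite mulf_eq0 sqrf_eq0 => /orP[/eqP//|]; rewrite subr_eq0 => /eqP ea.
  by move: a1; rewrite -ea normr1 ltxx.
(* Each of these three functions adds the contributions of the two steps inside a block, so its
   block averages are those of the paired sums in [ahat_den], in the sum of squares and in the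
   numerator of [ahat]. *)
have hx : measurable_fun setT (fun v : R * R * R => v.1.1 * v.1.1 + v.1.2 * v.1.2).
  by apply: measurable_funD; exact: measurable_funM.
have hy : measurable_fun setT (fun v : R * R * R => v.1.2 * v.1.2 + v.2 * v.2).
  by apply: measurable_funD; exact: measurable_funM.
have hz : measurable_fun setT (fun v : R * R * R => v.1.1 * v.1.2 + v.1.2 * v.2).
  by apply: measurable_funD; exact: measurable_funM.
have c2 : 0 <= 1 + 1 :> R by [].
have A1 := ergodic _ _ c2 hx (quad_lipschitzD lx ly).
have A2 := ergodic _ _ c2 hy (quad_lipschitzD ly lz).
have A3 := ergodic _ _ c2 hz (quad_lipschitzD lxy lyz).
have A4 := ergodic _ _ C0 mlU lsU.
have e1 : esp P (fun w => X 2 w * X 2 w + X 3 w * X 3 w) = 2 * s ^+ 2.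
  have [i2 e2] := sqrX 2 isT; have [i3 e3] := sqrX 3 isT.
  by rewrite espD ?[esp _ _]e2 ?[esp _ _]e3//; ring.
have e2 : esp P (fun w => X 3 w * X 3 w + X 4 w * X 4 w) = 2 * s ^+ 2.
  have [i3 e3] := sqrX 3 isT; have [i4 e4] := sqrX 4 isT.
  by rewrite espD ?[esp _ _]e3 ?[esp _ _]e4//; ring.
have e3 : esp P (fun w => X 2 w * X 3 w + X 3 w * X 4 w) = 2 * (a * s ^+ 2).
  by rewrite espD ?mulX1//; [ring|exact: mulX|exact: mulX].
apply: filterS2 (filterI A1 A2) (filterI A3 A4) => w [] /=.
rewrite e1 e2 e3 => {}A1 {}A2 [{}A3 {}A4].
apply: (@wealth_growth _ _ a s sigma) => //.
by rewrite mulrCA divff// mulr1.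
Qed.
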